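(* The set of pairs $(\alpha,\beta)\in\mathbb{R}^2$ satisfying $$\liminf_{q\to+\infty}\, q\,(\log q)^2\,\|q\alpha\|\,\|q\beta\|>0$$ (where $q$ runs over positive integers) has Hausdorff dimension $2$.
   Context: For a real number $x$, $\|x\|$ denotes the distance from $x$ to the nearest integer. *)

(* Defs.v *)
From Stdlib Require Import Reals Lra.
Open Scope R_scope.

Definition dist_int (x : R) : R := Rmin (frac_part x) (1 - frac_part x).

Definition dist2 (x y : R * R) : R :=
  sqrt ((fst x - fst y) ^ 2 + (snd x - snd y) ^ 2).

(* liminf_{n -> +oo} u n > 0 (in the extended reals), written out:
   there is c > 0 with u n >= c for all large n. *)
Definition liminf_pos (u : nat -> R) : Prop :=
  exists c, 0 < c /\ exists N, forall n, (N <= n)%nat -> c <= u n.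

Definition hausdorff_null (s : R) (E : R * R -> Prop) : Prop :=
  forall eps, 0 < eps ->
    exists (U : nat -> R * R -> Prop) (d : nat -> R),
      (forall n, 0 < d n) /\
      (forall n x y, U n x -> U n y -> dist2 x y <= d n) /\
      (forall x, E x -> exists n, U n x) /\
      (forall N, sum_f_R0 (fun n => Rpower (d n) s) N <= eps).

Definition is_glb (S : R -> Prop) (m : R) : Prop :=
  (forall s, S s -> m <= s) /\ (forall m', (forall s, S s -> m' <= s) -> m' <= m).

Definition hausdorff_dim (E : R * R -> Prop) (dim : R) : Prop :=
  is_glb (fun s => 0 <= s /\ hausdorff_null s E) dim.

Definition bad_set : R * R -> Prop := fun p =>
  liminf_pos (fun n => let q := INR (S n) in
    q * (ln q) ^ 2 * dist_int (q * fst p) * dist_int (q * snd p)).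

(* Main.v *)
Require Import Defs.
From Stdlib Require Import Reals ZArith Lra Lia ClassicalEpsilon.
Open Scope R_scope.

(* The lower bound is a slicing argument. A cover of the set with small [s]-dimensional
   sum, [s < 2], is first projected to the [x]-axis: inside a Cantor set of badly
   approximable numbers one finds [x] over which the slices of the cover have small
   [s/2]-dimensional sum. For such [x] the sum of [1 / ||q x||] over [2^m <= q < 2^(m+1)]
   is [O (m 2^m)], so the neighbourhoods of the fractions [p/q] to be removed from the
   [y]-axis for this block have total measure [O (1/m)]. The blocks with [L <= m < 3 L]
   together remove a small constant proportion of every interval of length [2^-L], and
   they are resolved at scale [2^(-9 L)]; going from scale [2^-L] to [2^(-3 L)], a quarter
   of the subintervals survives (Peres and Schlag). In both steps a point avoiding the
   cover is reached by descending through surviving cells along which a potential,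
   bounding the expected weight of the cover, does not increase. *)

(** * Finite sums and counting *)

(** Having exactly [n] terms, where [sum_f_R0] has [n + 1], allows the empty sum and lets blocks
    concatenate without index shifts. *)
Fixpoint rsum (f : nat -> R) (n : nat) : R :=
  match n with O => 0 | S m => rsum f m + f m end.

Definition indicator (P : Prop) : R := if excluded_middle_informative P then 1 else 0.

Definition cnt (P : nat -> Prop) (n : nat) : R := rsum (fun i => indicator (P i)) n.

Lemma indicator_true (P : Prop) : P -> indicator P = 1.
Proof. intros H; unfold indicator; destruct (excluded_middle_informative P); tauto. Qed.

Lemma indicator_false (P : Prop) : ~ P -> indicator P = 0.
Proof. intros H; unfold indicator; destruct (excluded_middle_informative P); tauto. Qed.

Lemma indicator_bounds (P : Prop) : 0 <= indicator P <= 1.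
Proof. unfold indicator; destruct (excluded_middle_informative P); lra. Qed.

Lemma indicator_le (P Q : Prop) : (P -> Q) -> indicator P <= indicator Q.
Proof.
  intros H; destruct (classic P) as [p|p].
  - rewrite (indicator_true P p), (indicator_true Q (H p)); lra.
  - rewrite (indicator_false P p); apply indicator_bounds.
Qed.

Lemma rsum_le (f g : nat -> R) (n : nat) :
  (forall i, (i < n)%nat -> f i <= g i) -> rsum f n <= rsum g n.
Proof.
  induction n as [|n IH]; intros H; simpl; [lra|].
  apply Rplus_le_compat; [apply IH; intros; apply H; lia | apply H; lia].
Qed.

Lemma rsum_ext (f g : nat -> R) (n : nat) :
  (forall i, (i < n)%nat -> f i = g i) -> rsum f n = rsum g n.
Proof.
  intros H; apply Rle_antisym; apply rsum_le; intros i Hi; rewrite (H i Hi); lra.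
Qed.

Lemma rsum_plus (f g : nat -> R) (n : nat) :
  rsum (fun i => f i + g i) n = rsum f n + rsum g n.
Proof. induction n as [|n IH]; simpl; lra. Qed.

Lemma rsum_scal (c : R) (f : nat -> R) (n : nat) :
  rsum (fun i => c * f i) n = c * rsum f n.
Proof. induction n as [|n IH]; simpl; [ring | rewrite IH; ring]. Qed.

Lemma rsum_const (c : R) (n : nat) : rsum (fun _ => c) n = INR n * c.
Proof. induction n as [|n IH]; [simpl; ring | rewrite S_INR; simpl; rewrite IH; ring]. Qed.

Lemma rsum_bound (f : nat -> R) (c : R) (n : nat) :
  (forall i, (i < n)%nat -> f i <= c) -> rsum f n <= INR n * c.
Proof. intros H; rewrite <- rsum_const; apply rsum_le, H. Qed.

Lemma rsum_nonneg (f : nat -> R) (n : nat) :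
  (forall i, (i < n)%nat -> 0 <= f i) -> 0 <= rsum f n.
Proof.
  intros H; replace 0 with (rsum (fun _ => 0) n) by (rewrite rsum_const; ring).
  apply rsum_le, H.
Qed.

Lemma rsum_exchange (f : nat -> nat -> R) (n m : nat) :
  rsum (fun i => rsum (f i) m) n = rsum (fun j => rsum (fun i => f i j) n) m.
Proof.
  induction n as [|n IH]; simpl.
  - rewrite rsum_const; ring.
  - rewrite IH, rsum_plus; reflexivity.
Qed.

Lemma rsum_add (f : nat -> R) (n m : nat) :
  rsum f (n + m) = rsum f n + rsum (fun i => f (n + i)%nat) m.
Proof.
  induction m as [|m IH].
  - rewrite Nat.add_0_r; simpl; ring.
  - rewrite Nat.add_succ_r; simpl; rewrite IH; ring.
Qed.

Lemma rsum_blocks (f : nat -> R) (a b : nat) :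
  rsum f (a * b) = rsum (fun i => rsum (fun j => f (i * b + j)%nat) b) a.
Proof.
  induction a as [|a IH]; simpl; [reflexivity|].
  rewrite Nat.add_comm, rsum_add, IH; reflexivity.
Qed.

Lemma rsum_mono (f : nat -> R) (n m : nat) :
  (forall i, 0 <= f i) -> (n <= m)%nat -> rsum f n <= rsum f m.
Proof.
  intros H Hnm; replace m with (n + (m - n))%nat by lia.
  rewrite rsum_add; assert (0 <= rsum (fun i => f (n + i)%nat) (m - n)); [|lra].
  apply rsum_nonneg; intros; apply H.
Qed.

Lemma rsum_term_le (f : nat -> R) (n i : nat) :
  (forall j, 0 <= f j) -> (i < n)%nat -> f i <= rsum f n.
Proof.
  intros H Hi; apply Rle_trans with (rsum f (S i)); [|apply rsum_mono; auto].
  simpl; assert (0 <= rsum f i) by (apply rsum_nonneg; auto); lra.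
Qed.

Lemma sum_f_R0_rsum (f : nat -> R) (n : nat) : sum_f_R0 f n = rsum f (S n).
Proof. induction n as [|n IH]; [simpl; ring | simpl sum_f_R0; rewrite IH; reflexivity]. Qed.

Lemma indicator_exists_le (P : nat -> Prop) (n : nat) :
  indicator (exists i, (i < n)%nat /\ P i) <= cnt P n.
Proof.
  destruct (classic (exists i, (i < n)%nat /\ P i)) as [H|H].
  - rewrite (indicator_true _ H); destruct H as [i [Hi HP]].
    rewrite <- (indicator_true _ HP).
    apply (rsum_term_le (fun i => indicator (P i))); [intros; apply indicator_bounds | exact Hi].
  - rewrite (indicator_false _ H); apply rsum_nonneg; intros; apply indicator_bounds.
Qed.

Lemma cnt_le (P Q : nat -> Prop) (n : nat) :
  (forall i, (i < n)%nat -> P i -> Q i) -> cnt P n <= cnt Q n.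
Proof. intros H; apply rsum_le; intros i Hi; apply indicator_le, H, Hi. Qed.

Lemma cnt_compl (P Q : nat -> Prop) (n : nat) :
  (forall i, (i < n)%nat -> P i \/ Q i) -> INR n <= cnt P n + cnt Q n.
Proof.
  intros H; unfold cnt; rewrite <- rsum_plus.
  replace (INR n) with (rsum (fun _ => 1) n) by (rewrite rsum_const; ring).
  apply rsum_le; intros i Hi; pose proof (indicator_bounds (P i)); pose proof (indicator_bounds (Q i)).
  destruct (H i Hi) as [p|p]; rewrite (indicator_true _ p) in *; lra.
Qed.

Lemma cnt_or (P Q : nat -> Prop) (n : nat) :
  cnt (fun i => P i \/ Q i) n <= cnt P n + cnt Q n.
Proof.
  unfold cnt; rewrite <- rsum_plus; apply rsum_le; intros i _.
  pose proof (indicator_bounds (P i)); pose proof (indicator_bounds (Q i)).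
  destruct (classic (P i \/ Q i)) as [p|p].
  - destruct p as [p|p]; rewrite (indicator_true _ p); rewrite indicator_true by tauto; lra.
  - rewrite (indicator_false _ p); lra.
Qed.

(** All counted indices lie between the first and the last of them. [B] is real because the spread
    is always bounded through a length. *)
Lemma cnt_window (P : nat -> Prop) (B : R) (n : nat) :
  0 <= B ->
  (forall i j, (i < n)%nat -> (j < n)%nat -> P i -> P j -> INR j - INR i <= B) ->
  cnt P n <= B + 1.
Proof.
  intros HB H.
  assert (K : forall m, (m <= n)%nat -> cnt P m = 0 \/
    exists i j, (i < m)%nat /\ (j < m)%nat /\ P i /\ P j /\ cnt P m <= INR j - INR i + 1).
  { induction m as [|m IH]; intros Hm; [left; reflexivity|].
    unfold cnt in *; simpl.
    destruct (classic (P m)) as [p|p].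
    - right; rewrite (indicator_true _ p).
      destruct IH as [E|[i [j [Hi [Hj [Pi [Pj E]]]]]]]; [lia | |].
      + exists m, m; repeat split; auto; lra.
      + exists i, m; repeat split; auto.
        assert (INR j + 1 <= INR m) by (rewrite <- S_INR; apply le_INR; lia); lra.
    - rewrite (indicator_false _ p).
      destruct IH as [E|[i [j [Hi [Hj [Pi [Pj E]]]]]]]; [lia | left; lra |].
      right; exists i, j; repeat split; auto; lra. }
  destruct (K n (le_n n)) as [E|[i [j [Hi [Hj [Pi [Pj E]]]]]]]; [lra|].
  pose proof (H i j Hi Hj Pi Pj); lra.
Qed.

(** Expand [f (phi i)] as a sum over [k] of [f k] times the indicator of [phi i = k]; after
    exchanging the sums, injectivity counts each [f k] at most once. *)
Lemma rsum_injection (f : nat -> R) (phi : nat -> nat) (n K : nat) :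
  (forall k, 0 <= f k) ->
  (forall i, (i < n)%nat -> (phi i < K)%nat) ->
  (forall i j, (i < n)%nat -> (j < n)%nat -> phi i = phi j -> i = j) ->
  rsum (fun i => f (phi i)) n <= rsum f K.
Proof.
  intros Hf Hphi Hinj.
  apply Rle_trans with (rsum (fun i => rsum (fun k => f k * indicator (phi i = k)) K) n).
  - apply rsum_le; intros i Hi.
    apply Rle_trans with (f (phi i) * indicator (phi i = phi i)).
    + rewrite indicator_true by reflexivity; lra.
    + apply (rsum_term_le (fun k => f k * indicator (phi i = k))); [|auto].
      intros k; apply Rmult_le_pos; [apply Hf | apply indicator_bounds].
  - rewrite rsum_exchange; apply rsum_le; intros k Hk.
    rewrite rsum_scal.
    assert (cnt (fun i => phi i = k) n <= 0 + 1).
    { apply cnt_window; [lra|]; intros i j Hi Hj E1 E2.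
      rewrite (Hinj i j Hi Hj) by congruence; lra. }
    unfold cnt in *; pose proof (Hf k); nra.
Qed.

(** * Descent through trees of cells *)

(** The interval [[i/D, (i+1)/D]] with the denominator cleared, closed so that nested cells have a
    common point. *)
Definition cell (D i : nat) (x : R) : Prop := INR i <= x * INR D <= INR i + 1.

Lemma cell_child (D r i j : nat) (x : R) :
  (0 < r)%nat -> (j < r)%nat -> cell (D * r) (i * r + j) x -> cell D i x.
Proof.
  unfold cell; rewrite plus_INR, !mult_INR; intros Hr Hj [H1 H2].
  assert (0 < INR r) by (apply lt_0_INR; lia).
  assert (INR j + 1 <= INR r) by (rewrite <- S_INR; apply le_INR; lia).
  pose proof (pos_INR j).
  split; apply Rmult_le_reg_r with (INR r); nra.
Qed.

Lemma cells_met_by_small_set (V : R -> Prop) (d : R) (D r i : nat) :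
  0 < d -> (0 < D)%nat ->
  (forall x y, V x -> V y -> Rabs (x - y) <= d) ->
  cnt (fun j => exists x, V x /\ cell D (i * r + j) x) r <= d * INR D + 2.
Proof.
  intros Hd HD HV.
  assert (0 < INR D) by (apply lt_0_INR; lia).
  replace (d * INR D + 2) with ((d * INR D + 1) + 1) by ring.
  apply cnt_window; [nra|].
  intros j j' _ _ [x [Vx [Hx1 Hx2]]] [y [Vy [Hy1 Hy2]]].
  rewrite plus_INR in *.
  pose proof (HV x y Vx Vy) as Hxy; pose proof (Rle_abs (y - x)) as Hyx; rewrite Rabs_minus_sym in Hyx.
  nra.
Qed.

(** A bound for the chance that a random descent from the cell ends in [V]. The factor 12 is 3 times
    4: a set of diameter [d] meets up to [3 max (1, d D r)] children, and only a quarter of the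
    children need be good. Once [d D >= 1] the weight is the bare indicator that [V] meets the
    cell. *)
Definition weight (s d : R) (V : R -> Prop) (D i : nat) : R :=
  Rmin 1 (12 * Rpower (d * INR D) s) * indicator (exists x, V x /\ cell D i x).

Lemma Rpower_pos (x s : R) : 0 < Rpower x s.
Proof. apply exp_pos. Qed.

Lemma Rpower_ge_1 (x s : R) : 1 <= x -> 0 <= s -> 1 <= Rpower x s.
Proof.
  intros Hx Hs; rewrite <- (Rpower_O x) by lra; apply Rle_Rpower; lra.
Qed.

Lemma Rpower_ge_self (x s : R) : 0 < x <= 1 -> s <= 1 -> x <= Rpower x s.
Proof.
  intros Hx Hs; unfold Rpower; rewrite <- (exp_ln x) at 1 by lra.
  assert (ln x <= 0) by (destruct (Req_dec x 1) as [->|]; [rewrite ln_1; lra|]; left; rewrite <- ln_1;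
    apply ln_increasing; lra).
  destruct (Req_dec (ln x) (s * ln x)) as [E|E]; [rewrite <- E; lra|].
  left; apply exp_increasing; nra.
Qed.

Lemma weight_bounds (s d : R) (V : R -> Prop) (D i : nat) : 0 <= weight s d V D i <= 1.
Proof.
  unfold weight; pose proof (indicator_bounds (exists x, V x /\ cell D i x)).
  pose proof (Rpower_pos (d * INR D) s).
  pose proof (Rmin_l 1 (12 * Rpower (d * INR D) s)).
  assert (0 <= Rmin 1 (12 * Rpower (d * INR D) s)) by (apply Rmin_glb; lra).
  nra.
Qed.

(* The weight is a supermartingale: a set of diameter [d] meets at most
   [3 max (1, d D r)] of the children, while the parent's weight is of order
   [(d D)^s], larger than [(d D r)^s / r] by the assumption on [r]. *)
Lemma weight_children (s d : R) (V : R -> Prop) (D r i : nat) (good : nat -> Prop) :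
  0 <= s <= 1 -> 0 < d -> (0 < D)%nat -> (0 < r)%nat ->
  12 * Rpower (INR r) s <= INR r ->
  (forall x y, V x -> V y -> Rabs (x - y) <= d) ->
  INR r / 4 <= cnt good r ->
  rsum (fun j => indicator (good j) * weight s d V (D * r) (i * r + j)) r
    <= cnt good r * weight s d V D i.
Proof.
  intros Hs Hd HD Hr HR HV Hgood.
  assert (PD : 0 < INR D) by (apply lt_0_INR; lia).
  assert (Pr : 0 < INR r) by (apply lt_0_INR; lia).
  destruct (classic (exists x, V x /\ cell D i x)) as [HI|HI].
  2:{ unfold weight at 2; rewrite (indicator_false _ HI).
      do 2 rewrite Rmult_0_r.
      replace 0 with (INR r * 0) by ring; apply rsum_bound; intros j Hj.
      unfold weight; rewrite (indicator_false (exists x, V x /\ cell (D * r) (i * r + j) x)); [lra|].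
      intros [x [Vx Hx]]; apply HI; exists x; split; [exact Vx|].
      apply (cell_child D r i j x); assumption. }
  unfold weight at 2; rewrite (indicator_true _ HI), Rmult_1_r.
  set (M := cnt good r) in *.
  set (dD := d * INR D); assert (PdD : 0 < dD) by (unfold dD; nra).
  assert (B1 : rsum (fun j => indicator (good j) * weight s d V (D * r) (i * r + j)) r <= M).
  { unfold M, cnt; apply rsum_le; intros j _.
    pose proof (indicator_bounds (good j)); pose proof (weight_bounds s d V (D * r) (i * r + j)); nra. }
  pose proof (cells_met_by_small_set V d (D * r) r i Hd ltac:(nia) HV) as HC.
  rewrite mult_INR in HC; replace (d * (INR D * INR r)) with (dD * INR r) in HC by (unfold dD; ring).
  assert (B2 : rsum (fun j => indicator (good j) * weight s d V (D * r) (i * r + j)) r <=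
    Rmin 1 (12 * Rpower (dD * INR r) s) * (dD * INR r + 2)).
  { apply Rle_trans with (Rmin 1 (12 * Rpower (dD * INR r) s) *
      cnt (fun j => exists x, V x /\ cell (D * r) (i * r + j) x) r).
    - unfold cnt; rewrite <- rsum_scal; apply rsum_le; intros j _.
      unfold weight; rewrite mult_INR.
      replace (d * (INR D * INR r)) with (dD * INR r) by (unfold dD; ring).
      pose proof (indicator_bounds (good j)).
      pose proof (indicator_bounds (exists x, V x /\ cell (D * r) (i * r + j) x)).
      pose proof (Rpower_pos (dD * INR r) s).
      assert (0 <= Rmin 1 (12 * Rpower (dD * INR r) s)) by (apply Rmin_glb; lra).
      set (m := Rmin _ _) in *; set (e := indicator (exists x, _)) in *.
      assert (0 <= m * e) by nra; nra.
    - apply Rmult_le_compat_l; [|exact HC].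
      pose proof (Rpower_pos (dD * INR r) s); apply Rmin_glb; lra. }
  destruct (Rle_or_lt 1 dD) as [H1|H1].
  { rewrite Rmin_left; [lra|].
    pose proof (Rpower_ge_1 dD s H1 (proj1 Hs)); lra. }
  assert (B3 : rsum (fun j => indicator (good j) * weight s d V (D * r) (i * r + j)) r <=
    M * (12 * Rpower dD s)).
  { apply Rle_trans with (1 := B2).
    destruct (Rle_or_lt 1 (dD * INR r)) as [H2|H2].
    - apply Rle_trans with (1 * (3 * (dD * INR r))).
      + apply Rmult_le_compat; [|nra|apply Rmin_l|lra].
        pose proof (Rpower_pos (dD * INR r) s); apply Rmin_glb; lra.
      + pose proof (Rpower_ge_self dD s ltac:(lra) (proj2 Hs)). nra.
    - apply Rle_trans with ((12 * Rpower (dD * INR r) s) * 3).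
      + apply Rmult_le_compat; [|nra|apply Rmin_r|lra].
        pose proof (Rpower_pos (dD * INR r) s); apply Rmin_glb; lra.
      + rewrite <- Rpower_mult_distr by lra.
        pose proof (Rpower_pos dD s). nra. }
  unfold Rmin; destruct (Rle_dec 1 (12 * Rpower dD s)); lra.
Qed.

(** Truncated at [N] because the cover is infinite; the descent keeps a bound uniform in [N]. *)
Definition potential (s : R) (w d : nat -> R) (V : nat -> R -> Prop) (D i N : nat) : R :=
  rsum (fun n => w n * weight s (d n) (V n) D i) N.

Lemma common_bound (P : nat -> nat -> Prop) (n : nat) :
  (forall j N N', (N <= N')%nat -> P j N -> P j N') ->
  (forall j, (j < n)%nat -> exists N, P j N) ->
  exists N, forall j, (j < n)%nat -> P j N.
Proof.
  intros Hm; induction n as [|n IH]; intros H.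
  - exists O; intros; lia.
  - destruct IH as [N HN]; [intros; apply H; lia|].
    destruct (H n ltac:(lia)) as [N' HN'].
    exists (Nat.max N N'); intros j Hj.
    destruct (Nat.eq_dec j n) as [->|E].
    + apply (Hm n N'); [lia|exact HN'].
    + apply (Hm j N); [lia|apply HN; lia].
Qed.

(** By [weight_children] the average of the potential over the good children is at most that of the
    parent, so some good child does not exceed [B]. *)
Lemma potential_child (s B : R) (w d : nat -> R) (V : nat -> R -> Prop)
    (D r i : nat) (good : nat -> Prop) :
  0 <= s <= 1 -> (0 < D)%nat -> (0 < r)%nat ->
  12 * Rpower (INR r) s <= INR r ->
  (forall n, 0 <= w n) -> (forall n, 0 < d n) ->
  (forall n x y, V n x -> V n y -> Rabs (x - y) <= d n) ->
  INR r / 4 <= cnt good r ->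
  (forall N, potential s w d V D i N <= B) ->
  exists j, (j < r)%nat /\ good j /\
    forall N, potential s w d V (D * r) (i * r + j) N <= B.
Proof.
  intros Hs HD Hr HR Hw Hd HV Hgood HB.
  assert (Pr : 0 < INR r) by (apply lt_0_INR; lia).
  apply NNPP; intros Hno.
  (* If each good child exceeded [B] at some truncation, then, partial sums being monotone in [N],
     one truncation would serve for all of them, and the averaging becomes a finite computation. *)
  destruct (common_bound (fun j N => good j ->
      B < potential s w d V (D * r) (i * r + j) N) r) as [N HN].
  { intros j N N' HNN' H Hg; specialize (H Hg); apply Rlt_le_trans with (1 := H).
    apply rsum_mono; [|exact HNN'].
    intros n; apply Rmult_le_pos; [apply Hw | apply weight_bounds]. }
  { intros j Hj; apply NNPP; intros Hn; apply Hno.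
    assert (Hg : good j) by (apply NNPP; intros Hg; apply Hn; exists O; tauto).
    exists j; repeat split; auto.
    intros N; apply Rnot_lt_le; intros Hlt; apply Hn; exists N; auto. }
  set (pot j := potential s w d V (D * r) (i * r + j) N).
  change (forall j, (j < r)%nat -> good j -> B < pot j) in HN.
  assert (U : rsum (fun j => indicator (good j) * pot j) r <= cnt good r * B).
  { apply Rle_trans with (cnt good r * potential s w d V D i N).
    2:{ apply Rmult_le_compat_l; [lra|apply HB]. }
    unfold pot, potential.
    rewrite <- rsum_scal.
    rewrite (rsum_ext _ (fun j => rsum (fun n => w n *
      (indicator (good j) * weight s (d n) (V n) (D * r) (i * r + j))) N)).
    2:{ intros j _; rewrite <- rsum_scal; apply rsum_ext; intros; ring. }
    rewrite rsum_exchange; apply rsum_le; intros n _.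
    rewrite rsum_scal.
    apply Rle_trans with (w n * (cnt good r * weight s (d n) (V n) D i)); [|right; ring].
    apply Rmult_le_compat_l; [apply Hw|].
    apply weight_children; auto. }
  assert (L : exists j, (j < r)%nat /\ good j).
  { apply NNPP; intros Hn.
    assert (cnt good r <= INR r * 0).
    { apply rsum_bound; intros j Hj; rewrite indicator_false; [lra|].
      intros Hg; apply Hn; exists j; auto. }
    lra. }
  destruct L as [j0 [Hj0 Hg0]].
  (* The terms are known to be nonnegative only for [j < r]; inserting [Rmax 0] makes them so for
     every [j], as [rsum_term_le] demands. *)
  assert (T : indicator (good j0) * (pot j0 - B) <= rsum (fun j => indicator (good j) * (pot j - B)) r).
  { rewrite (rsum_ext _ (fun j => Rmax 0 (indicator (good j) * (pot j - B)))).
    - apply Rle_trans with (Rmax 0 (indicator (good j0) * (pot j0 - B))); [apply Rmax_r|].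
      apply (rsum_term_le (fun j => Rmax 0 (indicator (good j) * (pot j - B)))); [|exact Hj0].
      intros; apply Rmax_l.
    - intros j Hj; rewrite Rmax_right; [reflexivity|].
      destruct (classic (good j)) as [g|g].
      + rewrite (indicator_true _ g); specialize (HN j Hj g); lra.
      + rewrite (indicator_false _ g); lra. }
  rewrite (rsum_ext _ (fun j => indicator (good j) * pot j + (- B) * indicator (good j))) in T
    by (intros; ring).
  rewrite rsum_plus, rsum_scal in T; fold (cnt good r) in T.
  rewrite (indicator_true _ Hg0) in T; specialize (HN j0 Hj0 Hg0).
  unfold cnt in *; lra.
Qed.

(** Packing each state with its invariant in a sigma type turns the choice of a successor into a
    function, which can be iterated. *)
Lemma dependent_choice_nat (P : nat -> nat -> Prop) (Q : nat -> nat -> nat -> Prop) :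
  P O O -> (forall k i, P k i -> exists i', Q k i i' /\ P (S k) i') ->
  exists u : nat -> nat, u O = O /\ (forall k, P k (u k)) /\ forall k, Q k (u k) (u (S k)).
Proof.
  intros H0 HS.
  assert (step : forall k (p : {i | P k i}), {q : {i | P (S k) i} | Q k (proj1_sig p) (proj1_sig q)}).
  { intros k [i Hi]; apply constructive_indefinite_description.
    destruct (HS k i Hi) as [i' [Hq Hp]]; exists (exist _ i' Hp); exact Hq. }
  set (v := fix v k : {i | P k i} := match k with
    | O => exist _ O H0 | S k' => proj1_sig (step k' (v k')) end).
  exists (fun k => proj1_sig (v k)); split; [reflexivity|split].
  - intros k; exact (proj2_sig (v k)).
  - intros k; simpl; exact (proj2_sig (step k (v k))).
Qed.

(** The point is the supremum of the left endpoints. Each left endpoint is at most each right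
    endpoint, since the left endpoint of the deeper of the two cells lies in both. *)
Lemma nested_cells_point (D u : nat -> nat) :
  (forall k, (0 < D k)%nat) ->
  (forall k x, cell (D (S k)) (u (S k)) x -> cell (D k) (u k) x) ->
  exists x, forall k, cell (D k) (u k) x.
Proof.
  intros HD Hnest.
  assert (PD : forall k, 0 < INR (D k)) by (intros; apply lt_0_INR, HD).
  assert (Hn : forall k m x, cell (D (m + k)%nat) (u (m + k)%nat) x -> cell (D k) (u k) x).
  { induction m as [|m IH]; intros x Hx; [exact Hx|]; apply IH, Hnest, Hx. }
  assert (Hl : forall k, cell (D k) (u k) (INR (u k) / INR (D k))).
  { intros k; unfold cell; specialize (PD k).
    replace (INR (u k) / INR (D k) * INR (D k)) with (INR (u k)) by (field; lra); lra. }
  assert (Hle : forall k m, INR (u k) / INR (D k) <= (INR (u m) + 1) / INR (D m)).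
  { intros k m.
    set (M := Nat.max k m).
    pose proof (Hn k (M - k)%nat (INR (u M) / INR (D M))) as H1.
    pose proof (Hn m (M - m)%nat (INR (u M) / INR (D M))) as H2.
    replace (M - k + k)%nat with M in H1 by lia.
    replace (M - m + m)%nat with M in H2 by lia.
    destruct (H1 (Hl M)) as [H1' _]; destruct (H2 (Hl M)) as [_ H2'].
    apply Rle_trans with (INR (u M) / INR (D M)).
    - apply Rmult_le_reg_r with (INR (D k)); [apply PD|].
      replace (INR (u k) / INR (D k) * INR (D k)) with (INR (u k)); [exact H1'|].
      field; specialize (PD k); lra.
    - apply Rmult_le_reg_r with (INR (D m)); [apply PD|].
      replace ((INR (u m) + 1) / INR (D m) * INR (D m)) with (INR (u m) + 1); [exact H2'|].
      field; specialize (PD m); lra. }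
  destruct (completeness (fun y => exists k, y = INR (u k) / INR (D k))) as [x [Hub Hlub]].
  { exists ((INR (u O) + 1) / INR (D O)); intros y [k ->]; apply Hle. }
  { exists (INR (u O) / INR (D O)), O; reflexivity. }
  exists x; intros k; specialize (PD k); split.
  - assert (H : INR (u k) / INR (D k) <= x) by (apply Hub; exists k; reflexivity).
    apply Rmult_le_compat_r with (r := INR (D k)) in H; [|lra].
    replace (INR (u k) / INR (D k) * INR (D k)) with (INR (u k)) in H by (field; lra).
    exact H.
  - assert (H : x <= (INR (u k) + 1) / INR (D k)).
    { apply Hlub; intros y [m ->]; apply Hle. }
    apply Rmult_le_compat_r with (r := INR (D k)) in H; [|lra].
    replace ((INR (u k) + 1) / INR (D k) * INR (D k)) with (INR (u k) + 1) in H by (field; lra).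
    exact H.
Qed.

(** The root cell [[0, / D 0]] has potential at most [12 (D 0)^s e], and [potential_child] preserves
    this bound along an infinite branch of good cells; the point is the limit of that branch. *)
Lemma tree_point (s e : R) (D r : nat -> nat) (good : nat -> nat -> Prop)
    (w d : nat -> R) (V : nat -> R -> Prop) :
  0 <= s <= 1 -> (0 < D O)%nat ->
  (forall k, D (S k) = (D k * r k)%nat) ->
  (forall k, (2 <= r k)%nat) ->
  (forall k, 12 * Rpower (INR (r k)) s <= INR (r k)) ->
  good O O ->
  (forall k i, good k i ->
     INR (r k) / 4 <= cnt (fun j => good (S k) (i * r k + j)%nat) (r k)) ->
  (forall n, 0 <= w n) -> (forall n, 0 < d n) ->
  (forall n x y, V n x -> V n y -> Rabs (x - y) <= d n) ->
  (forall N, rsum (fun n => w n * Rpower (d n) s) N <= e) ->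
  exists x, (forall k, exists i, good k i /\ cell (D k) i x) /\
    forall N, rsum (fun n => w n * indicator (V n x)) N <= 12 * Rpower (INR (D O)) s * e.
Proof.
  intros Hs HD0 HDS Hr HR Hg0 Hgood Hw Hd HV He.
  assert (HD : forall k, (2 ^ k <= D k)%nat).
  { induction k as [|k IH]; [simpl; lia|].
    rewrite HDS, Nat.pow_succ_r'; specialize (Hr k); nia. }
  assert (HDp : forall k, (0 < D k)%nat).
  { intros k; specialize (HD k); pose proof (Nat.pow_nonzero 2 k); lia. }
  set (B := 12 * Rpower (INR (D O)) s * e).
  destruct (dependent_choice_nat
    (fun k i => good k i /\ forall N, potential s w d V (D k) i N <= B)
    (fun k i i' => exists j, (j < r k)%nat /\ i' = (i * r k + j)%nat)) as [u [_ [Hu Hnest]]].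
  { split; [exact Hg0|]; intros N; unfold potential, B.
    apply Rle_trans with (12 * Rpower (INR (D O)) s * rsum (fun n => w n * Rpower (d n) s) N).
    - rewrite <- rsum_scal; apply rsum_le; intros n _.
      replace (12 * Rpower (INR (D O)) s * (w n * Rpower (d n) s)) with
        (w n * (12 * (Rpower (d n) s * Rpower (INR (D O)) s))) by ring.
      rewrite Rpower_mult_distr; [|apply Hd|apply lt_0_INR, HDp].
      apply Rmult_le_compat_l; [apply Hw|].
      unfold weight; pose proof (Rmin_r 1 (12 * Rpower (d n * INR (D O)) s)).
      pose proof (indicator_bounds (exists x, V n x /\ cell (D O) 0 x)).
      pose proof (Rpower_pos (d n * INR (D O)) s).
      assert (0 <= Rmin 1 (12 * Rpower (d n * INR (D O)) s)) by (apply Rmin_glb; lra).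
      nra.
    - apply Rmult_le_compat_l; [pose proof (Rpower_pos (INR (D O)) s); lra | apply He]. }
  { intros k i [Hg HP].
    destruct (potential_child s B w d V (D k) (r k) i (fun j => good (S k) (i * r k + j)%nat))
      as [j [Hj [Hgj HPj]]]; auto.
    { specialize (Hr k); lia. }
    exists (i * r k + j)%nat; rewrite HDS; split; [exists j; auto | auto]. }
  destruct (nested_cells_point D u HDp) as [x Hx].
  { intros k x Hx; destruct (Hnest k) as [j [Hj E]].
    rewrite HDS, E in Hx; apply (cell_child (D k) (r k) (u k) j x); auto; lia. }
  exists x; split.
  { intros k; exists (u k); split; [apply Hu | apply Hx]. }
  intros N.
  (* At a level whose cells are no longer than any of the first [N] diameters, the weights are plain
     indicators and dominate those of [V n x]. *)
  destruct (common_bound (fun n k => 1 <= d n * INR (D k)) N) as [k Hk].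
  { intros n k k' Hkk' H; apply Rle_trans with (1 := H).
    apply Rmult_le_compat_l; [left; apply Hd|]; apply le_INR.
    clear -Hkk' HDS Hr; induction Hkk' as [|k' _ IH]; [lia|].
    rewrite HDS; specialize (Hr k'); nia. }
  { intros n _.
    destruct (Pow_x_infinity 2 ltac:(rewrite Rabs_right; lra) (/ d n)) as [k Hk].
    exists k; specialize (Hk k (le_n k)); specialize (Hd n).
    rewrite Rabs_right in Hk by (apply Rle_ge, pow_le; lra).
    assert (2 ^ k <= INR (D k)).
    { replace 2 with (INR 2) by reflexivity; rewrite <- pow_INR; apply le_INR, HD. }
    apply Rmult_le_reg_l with (/ d n); [apply Rinv_0_lt_compat; lra|].
    rewrite <- Rmult_assoc, Rinv_l, Rmult_1_l, Rmult_1_r by lra; lra. }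
  apply Rle_trans with (2 := proj2 (Hu k) N).
  apply rsum_le; intros n Hn; apply Rmult_le_compat_l; [apply Hw|].
  unfold weight.
  rewrite Rmin_left.
  2:{ pose proof (Rpower_ge_1 _ s (Hk n Hn) (proj1 Hs)); lra. }
  rewrite Rmult_1_l; apply indicator_le; intros Vx; exists x; auto.
Qed.

(** * Badly approximable numbers *)

Lemma dist_int_le (x : R) (z : Z) : dist_int x <= Rabs (x - IZR z).
Proof.
  unfold dist_int; destruct (base_fp x) as [H1 H2]; unfold frac_part in *.
  set (m := Int_part x) in *.
  destruct (Z_le_gt_dec z m) as [H|H].
  - apply IZR_le in H; apply Rle_trans with (1 := Rmin_l _ _).
    rewrite Rabs_right; lra.
  - assert (H' : (m + 1 <= z)%Z) by lia; apply IZR_le in H'; rewrite plus_IZR in H'.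
    apply Rle_trans with (1 := Rmin_r _ _); rewrite Rabs_left1; lra.
Qed.

Lemma dist_int_attained (x : R) : exists z : Z, dist_int x = Rabs (x - IZR z).
Proof.
  unfold dist_int; destruct (base_fp x) as [H1 H2].
  unfold Rmin; destruct (Rle_dec _ _); unfold frac_part in *.
  - exists (Int_part x); rewrite Rabs_right; lra.
  - exists (Int_part x + 1)%Z; rewrite plus_IZR, Rabs_left1; lra.
Qed.

Lemma fraction_separation (p p' : Z) (q q' : nat) :
  IZR p * INR q' <> IZR p' * INR q -> 1 <= Rabs (IZR p * INR q' - IZR p' * INR q).
Proof.
  rewrite !INR_IZR_INZ, <- !mult_IZR, <- minus_IZR, <- abs_IZR; intros H.
  apply IZR_le.
  assert (p * Z.of_nat q' <> p' * Z.of_nat q)%Z by (intros E; apply H; rewrite E; reflexivity).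
  lia.
Qed.

(* All fractions of denominator at most [sqrt D / 2] that come close to a cell of length
   [/ D] coincide, so only the children next to one point are lost. *)
Lemma cells_near_fractions (D r i : nat) :
  (0 < D)%nat -> (16 <= r)%nat ->
  cnt (fun j => exists x q p, cell (D * r) (i * r + j) x /\ (1 <= q)%nat /\
      (4 * q * q <= D)%nat /\ (D < 4 * q * q * r)%nat /\
      Rabs (INR q * x - IZR p) < / (4 * INR r * INR r) / INR q) r <= 4.
Proof.
  intros HD Hr.
  assert (PD : 0 < INR D) by (apply lt_0_INR; lia).
  assert (Pr : 16 <= INR r) by (replace 16 with (INR 16) by (simpl; lra); apply le_INR; lia).
  set (h := / (INR D * INR r)).
  assert (Ph : 0 < h) by (apply Rinv_0_lt_compat; nra).
  (* Dividing by [q] gives [/ (4 r^2 q^2)], which [D < 4 q^2 r] makes smaller than one child length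
     [h]. *)
  assert (Near : forall x q p, (1 <= q)%nat -> (D < 4 * q * q * r)%nat ->
    Rabs (INR q * x - IZR p) < / (4 * INR r * INR r) / INR q ->
    Rabs (x - IZR p / INR q) < h).
  { intros x q p Hq HqD H.
    assert (Pq : 0 < INR q) by (apply lt_0_INR; lia).
    assert (HqD' : INR D < 4 * INR q * INR q * INR r).
    { apply lt_INR in HqD; rewrite !mult_INR in HqD; simpl in HqD; lra. }
    replace (x - IZR p / INR q) with ((INR q * x - IZR p) * / INR q) by (field; lra).
    rewrite Rabs_mult, (Rabs_right (/ INR q)) by (left; apply Rinv_0_lt_compat; lra).
    apply Rlt_trans with (/ (4 * INR r * INR r) / INR q * / INR q).
    - apply Rmult_lt_compat_r; [apply Rinv_0_lt_compat; lra | exact H].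
    - unfold h; replace (/ (4 * INR r * INR r) / INR q * / INR q) with
        (/ ((4 * INR q * INR q * INR r) * INR r)) by (field; lra).
      apply Rinv_lt_contravar; [|nra].
      apply Rmult_lt_0_compat; [nra|]; assert (0 < INR q * INR q) by nra; nra. }
  apply Rle_trans with (3 + 1); [|lra]; apply cnt_window; [lra|].
  intros j j' Hj Hj' [x [q [p [Cx [Hq [HqD [HqD' Hxp]]]]]]] [y [q' [p' [Cy [Hq' [Hq'D [Hq'D' Hyp]]]]]]].
  pose proof (Near x q p Hq HqD' Hxp) as Nx.
  pose proof (Near y q' p' Hq' Hq'D' Hyp) as Ny.
  assert (Pq : 0 < INR q) by (apply lt_0_INR; lia).
  assert (Pq' : 0 < INR q') by (apply lt_0_INR; lia).
  assert (Dx : cell D i x) by (apply (cell_child D r i j x); auto; lia).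
  assert (Dy : cell D i y) by (apply (cell_child D r i j' y); auto; lia).
  apply Rabs_def2 in Nx; apply Rabs_def2 in Ny.
  (* Distinct fractions would be at least [4 / D] apart because [4 q q' <= D], yet both lie within
     [h] of one cell of length [/ D], hence less than [2 / D] apart. *)
  assert (E : IZR p / INR q = IZR p' / INR q').
  { apply NNPP; intros Hne.
    assert (Hne' : IZR p * INR q' <> IZR p' * INR q).
    { intros E; apply Hne; apply Rmult_eq_reg_r with (INR q * INR q'); [|nra].
      replace (IZR p / INR q * (INR q * INR q')) with (IZR p * INR q') by (field; lra).
      replace (IZR p' / INR q' * (INR q * INR q')) with (IZR p' * INR q) by (field; lra).
      exact E. }
    apply fraction_separation in Hne'.
    replace (IZR p * INR q' - IZR p' * INR q) with
      ((IZR p / INR q - IZR p' / INR q') * (INR q * INR q')) in Hne' by (field; lra).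
    rewrite Rabs_mult, (Rabs_right (INR q * INR q')) in Hne' by nra.
    assert (Hqq : 4 * (INR q * INR q') <= INR D).
    { apply Rle_trans with (INR (4 * q * q')).
      - rewrite !mult_INR; simpl; right; ring.
      - apply le_INR; nia. }
    assert (Hclose : Rabs (IZR p / INR q - IZR p' / INR q') < 2 / INR D).
    { unfold cell in *.
      assert (hD : h * INR D = / INR r) by (unfold h; field; lra).
      assert (rD : / INR r <= / 16) by (apply Rinv_le_contravar; lra).
      assert (2 / INR D * INR D = 2) by (field; lra).
      destruct Nx as [Nx1 Nx2]; destruct Ny as [Ny1 Ny2].
      apply (Rmult_lt_compat_r (INR D)) in Nx1, Nx2, Ny1, Ny2; try exact PD.
      apply Rabs_def1; apply Rmult_lt_reg_r with (INR D); lra. }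
    assert (2 / INR D * INR D = 2) by (field; lra).
    apply (Rmult_lt_compat_r (INR D)) in Hclose; [|exact PD].
    pose proof (Rabs_pos (IZR p / INR q - IZR p' / INR q')).
    nra. }
  (* Both points are now within one child length of the same fraction, so their child indices differ
     by less than 3. *)
  rewrite <- E in Ny.
  unfold cell in Cx, Cy; rewrite plus_INR, !mult_INR in *.
  assert (hD : h * (INR D * INR r) = 1) by (unfold h; field; lra).
  assert (0 < INR D * INR r) by nra.
  destruct Nx as [Nx1 Nx2]; destruct Ny as [Ny1 Ny2].
  apply (Rmult_lt_compat_r (INR D * INR r)) in Nx1, Nx2, Ny1, Ny2; try assumption.
  lra.
Qed.

(** Subdivide [[0, 1]] with constant ratio [r = 2^a], asking at level [k] only for denominators with
    [4 q^2 r <= r^k]. This is vacuous at the root, and the denominators new at each level cost at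
    most 4 of the [r >= 16] children. *)
Lemma badly_approximable_point (s e : R) (a : nat) (w d : nat -> R) (V : nat -> R -> Prop) :
  0 <= s <= 1 -> (4 <= a)%nat -> 12 * Rpower (2 ^ a) s <= 2 ^ a ->
  (forall n, 0 <= w n) -> (forall n, 0 < d n) ->
  (forall n x y, V n x -> V n y -> Rabs (x - y) <= d n) ->
  (forall N, rsum (fun n => w n * Rpower (d n) s) N <= e) ->
  exists x, (forall q, (1 <= q)%nat -> / 2 ^ (2 * a + 2) / INR q <= dist_int (INR q * x)) /\
    forall N, rsum (fun n => w n * indicator (V n x)) N <= 12 * e.
Proof.
  intros Hs Ha HR Hw Hd HV He.
  set (r := (2 ^ a)%nat).
  assert (Er : INR r = 2 ^ a) by (unfold r; rewrite pow_INR; reflexivity).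
  assert (Hr : (16 <= r)%nat) by (apply (Nat.pow_le_mono_r 2 4 a); lia).
  assert (Pr : 16 <= INR r) by (replace 16 with (INR 16) by (simpl; lra); apply le_INR; lia).
  set (c := / (4 * INR r * INR r)).
  assert (Ec : / 2 ^ (2 * a + 2) = c).
  { unfold c; rewrite Er; f_equal.
    replace (2 * a + 2)%nat with (2 + (a + a))%nat by lia.
    rewrite !pow_add; simpl; ring. }
  destruct (tree_point s e (fun k => r ^ k)%nat (fun _ => r)
    (fun k i => forall x q p, cell (r ^ k) i x -> (1 <= q)%nat -> (4 * q * q * r <= r ^ k)%nat ->
      c / INR q <= Rabs (INR q * x - IZR p)) w d V) as [x [Hx Hsum]]; auto.
  - intros k; rewrite Nat.pow_succ_r'; lia.
  - intros; lia.
  - intros; rewrite Er; exact HR.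
  - intros x q p _ Hq H; exfalso; change (r ^ 0)%nat with 1%nat in H; nia.
  - intros k i Hgood.
    assert (Hpos : (0 < r ^ k)%nat) by (pose proof (Nat.pow_nonzero r k); lia).
    pose proof (cells_near_fractions (r ^ k) r i Hpos Hr) as Hbad.
    set (Bad := fun j => _) in Hbad.
    set (good := fun j => _).
    assert (INR r <= cnt good r + cnt Bad r).
    { apply cnt_compl; intros j Hj.
      destruct (classic (Bad j)) as [|Hb]; [right; assumption|left].
      intros x q p Cx Hq HqD.
      rewrite Nat.pow_succ_r', (Nat.mul_comm r) in HqD, Cx.
      destruct (le_lt_dec (4 * q * q * r) (r ^ k)) as [Hle|Hlt].
      - apply Hgood; auto; apply (cell_child (r ^ k) r i j x); auto; lia.
      - apply Rnot_lt_le; intros Hlt'; apply Hb; exists x, q, p; repeat split; auto;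
          try apply Cx; nia. }
    lra.
  - exists x; split.
    + intros q Hq; rewrite Ec.
      destruct (dist_int_attained (INR q * x)) as [p ->].
      (* This level reaches the denominator [q], because [n < r^n]. *)
      destruct (Hx (4 * q * q * r)%nat) as [i [Hg Ci]].
      apply (Hg x q p Ci Hq).
      apply Nat.lt_le_incl, Nat.pow_gt_lin_r; lia.
    + simpl in Hsum; intros N; specialize (Hsum N).
      replace (Rpower 1 s) with 1 in Hsum; [lra|].
      unfold Rpower; rewrite ln_1, Rmult_0_r, exp_0; reflexivity.
Qed.

(** * Reciprocal sums of distances to the integers over dyadic blocks *)

Lemma harmonic_dyadic_le (e : nat) : rsum (fun k => / INR (S k)) (2 ^ e - 1) <= INR e.
Proof.
  induction e as [|e IH]; [simpl; lra|].
  pose proof (Nat.pow_nonzero 2 e ltac:(lia)) as Hpos.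
  replace (2 ^ S e - 1)%nat with ((2 ^ e - 1) + 2 ^ e)%nat by (rewrite Nat.pow_succ_r'; lia).
  rewrite rsum_add, (S_INR e).
  assert (P : 0 < INR (2 ^ e)) by (apply lt_0_INR; lia).
  assert (rsum (fun i => / INR (S (2 ^ e - 1 + i))) (2 ^ e) <= INR (2 ^ e) * / INR (2 ^ e)).
  { apply rsum_bound; intros i _; apply Rinv_le_contravar; [exact P|].
    apply le_INR; lia. }
  rewrite Rinv_r in H by lra; lra.
Qed.

(* The index of the cell of length [2^-e] containing [f i] is injective in [i],
   which compares the sum with a harmonic sum. *)
Lemma reciprocal_sum_separated (e n : nat) (f : nat -> R) :
  (forall i, (i < n)%nat -> / 2 ^ e <= f i < 1) ->
  (forall i j, (i < n)%nat -> (j < n)%nat -> i <> j -> / 2 ^ e <= Rabs (f i - f j)) ->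
  rsum (fun i => / f i) n <= 2 ^ e * INR e.
Proof.
  intros Hf Hsep.
  assert (Pe : 0 < 2 ^ e) by (apply pow_lt; lra).
  assert (Pie : 0 < / 2 ^ e) by (apply Rinv_0_lt_compat, Pe).
  (* The integer part is at least 1 because [f i >= / 2^e]; subtracting 1 matches the harmonic sum,
     whose term at [k] is [/ (k + 1)]. *)
  set (phi i := (Z.to_nat (Int_part (f i * 2 ^ e)) - 1)%nat).
  assert (Hphi : forall i, (i < n)%nat -> (phi i < 2 ^ e - 1)%nat /\
     INR (S (phi i)) <= f i * 2 ^ e < INR (S (phi i)) + 1).
  { intros i Hi; specialize (Hf i Hi).
    destruct (base_Int_part (f i * 2 ^ e)) as [H1 H2].
    assert (1 <= f i * 2 ^ e < 2 ^ e).
    { split; [|nra]; replace 1 with (/ 2 ^ e * 2 ^ e) by (field; lra).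
      apply Rmult_le_compat_r; lra. }
    assert (HZ : (1 <= Int_part (f i * 2 ^ e))%Z).
    { assert (0 < Int_part (f i * 2 ^ e))%Z by (apply lt_IZR; lra); lia. }
    assert (E : INR (S (phi i)) = IZR (Int_part (f i * 2 ^ e))).
    { unfold phi; rewrite INR_IZR_INZ; f_equal; lia. }
    rewrite E; split; [|lra].
    assert (S (phi i) < 2 ^ e)%nat; [|lia].
    apply INR_lt; rewrite E, pow_INR; change (INR 2) with 2; lra. }
  apply Rle_trans with (2 ^ e * rsum (fun i => / INR (S (phi i))) n).
  { rewrite <- rsum_scal; apply rsum_le; intros i Hi.
    destruct (Hphi i Hi) as [_ [H3 H4]].
    assert (0 < INR (S (phi i))) by (apply lt_0_INR; lia).
    replace (2 ^ e * / INR (S (phi i))) with (/ (INR (S (phi i)) * / 2 ^ e)) by (field; lra).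
    apply Rinv_le_contravar; [apply Rmult_lt_0_compat; lra|].
    apply Rmult_le_reg_r with (2 ^ e); [exact Pe|].
    rewrite Rmult_assoc, Rinv_l, Rmult_1_r by lra; exact H3. }
  apply Rmult_le_compat_l; [lra|].
  apply Rle_trans with (2 := harmonic_dyadic_le e).
  apply (rsum_injection (fun k => / INR (S k))).
  - intros k; left; apply Rinv_0_lt_compat, lt_0_INR; lia.
  - intros i Hi; apply Hphi, Hi.
  - intros i j Hi Hj E; apply NNPP; intros Hij.
    specialize (Hsep i j Hi Hj Hij).
    destruct (Hphi i Hi) as [_ [H1 H2]]; destruct (Hphi j Hj) as [_ [H3 H4]].
    rewrite <- E in H3, H4.
    apply Rle_not_lt in Hsep; apply Hsep.
    assert (/ 2 ^ e * 2 ^ e = 1) by (field; lra).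
    apply Rabs_def1; apply Rmult_lt_reg_r with (2 ^ e); lra.
Qed.

(** Differences of integers of the block are again below [2^(m+1)], so bad approximability keeps the
    fractional parts [2^-(m+1+b)] apart, and as far from 0 and 1. *)
Lemma reciprocal_sum_bad (x : R) (b m : nat) :
  (forall q, (1 <= q)%nat -> / 2 ^ b / INR q <= dist_int (INR q * x)) ->
  rsum (fun r => / dist_int (INR (2 ^ m + r) * x)) (2 ^ m) <= 4 * 2 ^ m * 2 ^ b * INR (m + 1 + b).
Proof.
  intros Hx.
  set (q := fun r => (2 ^ m + r)%nat).
  set (e := (m + 1 + b)%nat).
  assert (Ee : / 2 ^ e = / 2 ^ b / INR (2 ^ (m + 1))).
  { unfold e; rewrite pow_INR; change (INR 2) with 2; rewrite (pow_add 2 (m + 1) b).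
    field; split; apply pow_nonzero; lra. }
  assert (Pq : forall r, (r < 2 ^ m)%nat -> (1 <= q r < 2 ^ (m + 1))%nat).
  { intros r Hr; unfold q; rewrite Nat.pow_add_r; simpl; pose proof (Nat.pow_nonzero 2 m); lia. }
  assert (Hlow : forall k, (1 <= k < 2 ^ (m + 1))%nat -> / 2 ^ e <= dist_int (INR k * x)).
  { intros k Hk; apply Rle_trans with (2 := Hx k (proj1 Hk)); rewrite Ee.
    apply Rmult_le_compat_l; [left; apply Rinv_0_lt_compat, pow_lt; lra|].
    apply Rinv_le_contravar; [apply lt_0_INR; lia | apply le_INR; lia]. }
  assert (Pe : 0 < / 2 ^ e) by (apply Rinv_0_lt_compat, pow_lt; lra).
  assert (Hfp : forall r, (r < 2 ^ m)%nat ->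
    / 2 ^ e <= frac_part (INR (q r) * x) /\ / 2 ^ e <= 1 - frac_part (INR (q r) * x)).
  { intros r Hr; pose proof (Hlow _ (Pq r Hr)) as H; unfold dist_int in H.
    split; eapply Rle_trans; [exact H | apply Rmin_l | exact H | apply Rmin_r]. }
  assert (Hsep0 : forall i j, (i < j)%nat -> (j < 2 ^ m)%nat ->
    / 2 ^ e <= Rabs (frac_part (INR (q i) * x) - frac_part (INR (q j) * x))).
  { intros i j Hij Hj.
    apply Rle_trans with (dist_int (INR (j - i) * x)).
    - apply Hlow; rewrite Nat.pow_add_r; simpl; lia.
    - rewrite Rabs_minus_sym; unfold frac_part.
      replace (INR (q j) * x - IZR (Int_part (INR (q j) * x)) -
        (INR (q i) * x - IZR (Int_part (INR (q i) * x)))) with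
        (INR (j - i) * x - IZR (Int_part (INR (q j) * x) - Int_part (INR (q i) * x))).
      + apply dist_int_le.
      + rewrite minus_IZR, minus_INR by lia; unfold q; rewrite !plus_INR; ring. }
  assert (Hsep : forall i j, (i < 2 ^ m)%nat -> (j < 2 ^ m)%nat -> i <> j ->
    / 2 ^ e <= Rabs (frac_part (INR (q i) * x) - frac_part (INR (q j) * x))).
  { intros i j Hi Hj Hij; destruct (Nat.lt_gt_cases i j) as [H _].
    destruct (H Hij); [apply Hsep0; auto | rewrite Rabs_minus_sym; apply Hsep0; auto]. }
  assert (S1 : rsum (fun r => / frac_part (INR (q r) * x)) (2 ^ m) <= 2 ^ e * INR e).
  { apply reciprocal_sum_separated; [|exact Hsep].
    intros r Hr; split; [apply (Hfp r Hr)|]; apply base_fp. }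
  assert (S2 : rsum (fun r => / (1 - frac_part (INR (q r) * x))) (2 ^ m) <= 2 ^ e * INR e).
  { apply reciprocal_sum_separated.
    - intros r Hr; destruct (Hfp r Hr); split; lra.
    - intros i j Hi Hj Hij.
      replace (1 - frac_part (INR (q i) * x) - (1 - frac_part (INR (q j) * x))) with
        (- (frac_part (INR (q i) * x) - frac_part (INR (q j) * x))) by ring.
      rewrite Rabs_Ropp; apply Hsep; auto. }
  (* The reciprocal of a minimum is at most the sum of the two reciprocals, so the distances to 0
     and to 1 can be summed separately. *)
  apply Rle_trans with (rsum (fun r => / frac_part (INR (q r) * x) +
     / (1 - frac_part (INR (q r) * x))) (2 ^ m)).
  - apply rsum_le; intros r Hr; fold (q r); destruct (Hfp r Hr) as [H1 H2].
    assert (0 < / frac_part (INR (q r) * x)) by (apply Rinv_0_lt_compat; lra).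
    assert (0 < / (1 - frac_part (INR (q r) * x))) by (apply Rinv_0_lt_compat; lra).
    unfold dist_int, Rmin; destruct (Rle_dec _ _); lra.
  - rewrite rsum_plus.
    apply Rle_trans with (2 ^ e * INR e + 2 ^ e * INR e);
      [apply Rplus_le_compat; assumption|].
    right; unfold e; rewrite !pow_add; simpl; ring.
Qed.

(** * The exceptional set on a slice *)

(** On the cell [q y] runs over an interval of length [q / D], so at most [5 q / D] integers matter.
    The points near each form an interval of length [2 rho / q], which meets at most
    [2 rho D T / q + 2] subcells. *)
Lemma cells_near_multiples (D T q i : nat) (rho : R) :
  (0 < D <= q)%nat -> (0 < T)%nat -> 0 < rho <= 1 ->
  cnt (fun u => exists y, cell (D * T) (i * T + u) y /\ dist_int (INR q * y) < rho) T
    <= 10 * rho * INR T + 10 * INR q / INR D.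
Proof.
  intros [HD HDq] HT Hrho.
  assert (PD : 0 < INR D) by (apply lt_0_INR; lia).
  assert (PT : 0 < INR T) by (apply lt_0_INR; lia).
  assert (HDq' : INR D <= INR q) by (apply le_INR; lia).
  assert (Hratio : 1 <= INR q / INR D).
  { apply Rmult_le_reg_r with (INR D); [exact PD|].
    unfold Rdiv; rewrite Rmult_assoc, Rinv_l by lra; lra. }
  set (z := INR q * INR i / INR D).
  (* As [rho <= 1], an integer within [rho] of some [q y >= z] exceeds [z - 1], so [v0] is a safe
     first candidate; [n <= q / D + 4] candidates then suffice. *)
  set (v0 := (Int_part z - 1)%Z).
  destruct (archimed (INR q / INR D + 3)) as [Hup1 Hup2].
  set (n := Z.to_nat (up (INR q / INR D + 3))).
  assert (En : INR n = IZR (up (INR q / INR D + 3))).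
  { unfold n; rewrite INR_IZR_INZ, Z2Nat.id; [reflexivity|].
    apply le_IZR; lra. }
  destruct (base_Int_part z) as [Hz1 Hz2].
  assert (Ev0 : IZR v0 = IZR (Int_part z) - 1) by (unfold v0; rewrite minus_IZR; reflexivity).
  set (Q := fun v u => exists y, cell (D * T) (i * T + u) y /\
              Rabs (INR q * y - IZR (v0 + Z.of_nat v)) < rho).
  apply Rle_trans with (rsum (fun u => cnt (fun v => Q v u) n) T).
  { unfold cnt at 1; apply rsum_le; intros u Hu.
    apply Rle_trans with (2 := indicator_exists_le (fun v => Q v u) n).
    apply indicator_le; intros [y [Cy Hy]].
    assert (Hcell : cell D i y) by (apply (cell_child D T i u y); auto).
    destruct (dist_int_attained (INR q * y)) as [p Ep]; rewrite Ep in Hy.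
    pose proof (Rabs_def2 _ _ Hy) as [Hy1 Hy2].
    assert (Hqy : z <= INR q * y <= z + INR q / INR D).
    { unfold cell in Hcell; unfold z; split; apply Rmult_le_reg_r with (INR D); try exact PD.
      - replace (INR q * INR i / INR D * INR D) with (INR q * INR i) by (field; lra); nra.
      - replace ((INR q * INR i / INR D + INR q / INR D) * INR D) with
          (INR q * (INR i + 1)) by (field; lra); nra. }
    assert (Hp : (v0 <= p)%Z) by (apply le_IZR; lra).
    exists (Z.to_nat (p - v0)); split.
    - apply INR_lt; rewrite En, (INR_IZR_INZ (Z.to_nat _)), Z2Nat.id, minus_IZR by lia; lra.
    - exists y; split; [exact Cy|].
      replace (v0 + Z.of_nat (Z.to_nat (p - v0)))%Z with p by lia; exact Hy. }
  unfold cnt; rewrite rsum_exchange.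
  set (h := 2 * rho * (INR D * INR T) / INR q).
  assert (Eh : h * INR q = 2 * rho * (INR D * INR T)) by (unfold h; field; lra).
  assert (Hh : 0 <= h).
  { unfold h, Rdiv; apply Rmult_le_pos; [|left; apply Rinv_0_lt_compat; lra].
    assert (0 < INR D * INR T) by nra; nra. }
  apply Rle_trans with (INR n * (h + 1 + 1)).
  { apply rsum_bound; intros v _.
    apply (cnt_window (Q v)); [lra|].
    intros j j' _ _ [y [Cy Hy]] [y' [Cy' Hy']].
    unfold cell in *; rewrite plus_INR, !mult_INR in *.
    apply Rabs_def2 in Hy, Hy'.
    assert (Hd : INR q * (y' - y) < 2 * rho) by lra.
    assert ((y' - y) * (INR D * INR T) <= h).
    { apply Rmult_le_reg_r with (INR q); [lra|]; rewrite Eh.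
      assert (0 < INR D * INR T) by nra; nra. }
    lra. }
  apply Rle_trans with (5 * (INR q / INR D) * (h + 1 + 1)).
  - apply Rmult_le_compat_r; lra.
  - right; unfold h; field; lra.
Qed.

(* Over a block [2^m <= q < 2^(m+1)] these radii sum to [O (1/m)], by [reciprocal_sum_bad]. *)
Definition radius (x : R) (b m r : nat) : R :=
  / 2 ^ (b + 13) / (2 ^ m * INR m ^ 2 * dist_int (INR (2 ^ m + r) * x)).

Definition excluded (x : R) (b L L' : nat) (y : R) : Prop :=
  exists m r, (L <= m < L')%nat /\ (r < 2 ^ m)%nat /\
    dist_int (INR (2 ^ m + r) * y) < radius x b m r.

Lemma dist_int_bad_pos (x : R) (b : nat) :
  (forall q, (1 <= q)%nat -> / 2 ^ b / INR q <= dist_int (INR q * x)) ->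
  forall q, (1 <= q)%nat -> 0 < dist_int (INR q * x).
Proof.
  intros Hx q Hq; apply Rlt_le_trans with (2 := Hx q Hq).
  apply Rdiv_lt_0_compat; [apply Rinv_0_lt_compat, pow_lt; lra | apply lt_0_INR; lia].
Qed.

(** The upper bound 1 is what [cells_near_multiples] asks for. Since the denominator [q] is at most
    [2 * 2^m], bad approximability gives [2^m dist_int (q x) >= 2^-(b+1)], which the factor
    [2^(b+13)] outweighs. *)
Lemma radius_bounds (x : R) (b m r : nat) :
  (forall q, (1 <= q)%nat -> / 2 ^ b / INR q <= dist_int (INR q * x)) ->
  (1 <= m)%nat -> (r < 2 ^ m)%nat -> 0 < radius x b m r <= 1.
Proof.
  intros Hx Hm Hr.
  assert (Hq : (1 <= 2 ^ m + r)%nat) by (pose proof (Nat.pow_nonzero 2 m); lia).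
  pose proof (dist_int_bad_pos x b Hx _ Hq) as Hpos.
  assert (P2m : 0 < 2 ^ m) by (apply pow_lt; lra).
  assert (P2b : 0 < 2 ^ b) by (apply pow_lt; lra).
  assert (Pm : 1 <= INR m) by (replace 1 with (INR 1) by reflexivity; apply le_INR, Hm).
  assert (Eq : 0 < INR (2 ^ m + r) <= 2 * 2 ^ m).
  { split; [apply lt_0_INR; lia|].
    rewrite plus_INR, pow_INR; change (INR 2) with 2.
    apply Rle_trans with (2 ^ m + INR (2 ^ m)); [apply Rplus_le_compat_l, le_INR; lia|].
    rewrite pow_INR; change (INR 2) with 2; lra. }
  specialize (Hx _ Hq); set (q := INR (2 ^ m + r)) in *; set (dx := dist_int (q * x)) in *.
  unfold radius; fold q; fold dx.
  assert (Pden : 0 < 2 ^ m * INR m ^ 2 * dx) by (repeat apply Rmult_lt_0_compat; simpl; lra).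
  split; [apply Rdiv_lt_0_compat; [apply Rinv_0_lt_compat, pow_lt; lra | exact Pden]|].
  apply Rmult_le_reg_r with (2 ^ m * INR m ^ 2 * dx); [exact Pden|].
  unfold Rdiv; rewrite Rmult_assoc, Rinv_l, Rmult_1_r, Rmult_1_l by lra.
  apply Rle_trans with (2 ^ m * (/ 2 ^ b / q)).
  - apply Rle_trans with (2 ^ m * (/ 2 ^ b / (2 * 2 ^ m))).
    + rewrite pow_add; replace (2 ^ m * (/ 2 ^ b / (2 * 2 ^ m))) with (/ (2 ^ b * 2)) by (field; lra).
      apply Rinv_le_contravar; [lra|]; apply Rmult_le_compat_l; simpl; lra.
    + apply Rmult_le_compat_l; [lra|]; apply Rmult_le_compat_l.
      * left; apply Rinv_0_lt_compat; lra.
      * apply Rinv_le_contravar; lra.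
  - assert (1 <= INR m ^ 2) by (simpl; nra).
    assert (0 < 2 ^ m * dx) by nra.
    apply Rle_trans with (2 ^ m * dx); [apply Rmult_le_compat_l; lra|]; nra.
Qed.

(** The reciprocal sum costs a factor [m + 1 + b <= 2 m], which cancels one of the two powers of [m]
    in the radius. *)
Lemma radius_sum (x : R) (b m : nat) :
  (forall q, (1 <= q)%nat -> / 2 ^ b / INR q <= dist_int (INR q * x)) ->
  (b + 1 <= m)%nat -> rsum (radius x b m) (2 ^ m) <= 8 / 2 ^ 13 / INR m.
Proof.
  intros Hx Hm.
  pose proof (reciprocal_sum_bad x b m Hx) as HS.
  assert (P2m : 0 < 2 ^ m) by (apply pow_lt; lra).
  assert (P2b : 0 < 2 ^ b) by (apply pow_lt; lra).
  assert (Pm : 0 < INR m) by (apply lt_0_INR; lia).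
  set (k := / 2 ^ (b + 13) / (2 ^ m * INR m ^ 2)).
  assert (Pk : 0 < k).
  { apply Rdiv_lt_0_compat; [apply Rinv_0_lt_compat, pow_lt; lra | apply Rmult_lt_0_compat; [lra | apply pow_lt; lra]]. }
  rewrite (rsum_ext _ (fun r => k * / dist_int (INR (2 ^ m + r) * x))).
  2:{ intros r Hr; unfold radius, k, Rdiv; rewrite (Rinv_mult (2 ^ m * INR m ^ 2)); ring. }
  rewrite rsum_scal.
  apply Rle_trans with (k * (4 * 2 ^ m * 2 ^ b * (2 * INR m))).
  - apply Rmult_le_compat_l; [lra|]; apply Rle_trans with (1 := HS).
    apply Rmult_le_compat_l; [nra|].
    replace (2 * INR m) with (INR (2 * m)) by (rewrite mult_INR; simpl; ring).
    apply le_INR; lia.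
  - right; unfold k; rewrite pow_add; field; lra.
Qed.

(** With [D = 2^L] and [T = D^8], the measure terms of the [2 L] blocks are [O (T / L)] each and add
    up to [160 / 2^13] of [T]. The endpoint terms total at most [40 L D^5], negligible at this
    resolution. *)
Lemma cells_meeting_excluded (x : R) (b L i : nat) :
  (forall q, (1 <= q)%nat -> / 2 ^ b / INR q <= dist_int (INR q * x)) ->
  (5 <= L)%nat -> (b + 1 <= L)%nat ->
  cnt (fun u => exists y, cell (2 ^ L * 2 ^ (8 * L)) (i * 2 ^ (8 * L) + u) y /\
      excluded x b L (3 * L) y) (2 ^ (8 * L)) <= INR (2 ^ (8 * L)) / 8.
Proof.
  intros Hx HL HbL.
  set (T := (2 ^ (8 * L))%nat); set (D := (2 ^ L)%nat).
  assert (HT : (0 < T)%nat) by (unfold T; pose proof (Nat.pow_nonzero 2 (8 * L)); lia).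
  assert (HD : (32 <= D)%nat) by (apply (Nat.pow_le_mono_r 2 5 L); lia).
  assert (PD : 32 <= INR D) by (replace 32 with (INR 32) by (simpl; lra); apply le_INR, HD).
  assert (PT : 0 < INR T) by (apply lt_0_INR, HT).
  assert (ET : INR T = INR D ^ 8).
  { unfold T, D; rewrite !pow_INR, <- pow_mult; f_equal; lia. }
  assert (PL : 5 <= INR L) by (replace 5 with (INR 5) by (simpl; lra); apply le_INR, HL).
  assert (PLD : INR L <= INR D) by (apply le_INR, Nat.lt_le_incl, Nat.pow_gt_lin_r; lia).
  set (hit := fun v r u => exists y, cell (D * T) (i * T + u) y /\
    dist_int (INR (2 ^ (L + v) + r) * y) < radius x b (L + v) r).
  apply Rle_trans with (rsum (fun v => rsum (fun r => cnt (hit v r) T) (2 ^ (L + v))) (2 * L)).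
  { rewrite (rsum_ext _ (fun v => rsum (fun u => cnt (fun r => hit v r u) (2 ^ (L + v))) T)).
    2:{ intros v _; unfold cnt; apply rsum_exchange. }
    rewrite rsum_exchange; unfold cnt at 1; apply rsum_le; intros u _.
    apply Rle_trans with (cnt (fun v => exists r, (r < 2 ^ (L + v))%nat /\ hit v r u) (2 * L)).
    2:{ apply rsum_le; intros v _; apply (indicator_exists_le (fun r => hit v r u)). }
    apply Rle_trans with (2 := indicator_exists_le _ _).
    apply indicator_le; intros [y [Cy [m [r [Hm [Hr Hy]]]]]].
    exists (m - L)%nat; split; [lia|].
    exists r; unfold hit; replace (L + (m - L))%nat with m by lia.
    split; [exact Hr|]; exists y; split; assumption. }
  apply Rle_trans with (INR (2 * L) * (INR T * (80 / 2 ^ 13) / INR L + 20 * INR D ^ 5)).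
  { apply rsum_bound; intros v Hv; set (m := (L + v)%nat).
    assert (P2m : 0 < INR (2 ^ m)) by (apply lt_0_INR; pose proof (Nat.pow_nonzero 2 m); lia).
    assert (HDm : (D <= 2 ^ m)%nat) by (apply Nat.pow_le_mono_r; lia).
    apply Rle_trans with (rsum (fun r => 10 * INR T * radius x b m r +
       20 * INR (2 ^ m) / INR D) (2 ^ m)).
    { apply rsum_le; intros r Hr.
      apply Rle_trans with (10 * radius x b m r * INR T + 10 * INR (2 ^ m + r) / INR D).
      - unfold hit; fold m; apply cells_near_multiples; [lia|lia|].
        apply radius_bounds; auto; lia.
      - apply Rplus_le_compat; [right; ring|].
        apply Rmult_le_compat_r; [left; apply Rinv_0_lt_compat; lra|].
        apply le_INR in Hr; rewrite S_INR in Hr; rewrite plus_INR; lra. }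
    rewrite rsum_plus, rsum_scal, rsum_const.
    apply Rplus_le_compat.
    - apply Rle_trans with (10 * INR T * (8 / 2 ^ 13 / INR m)).
      + apply Rmult_le_compat_l; [lra|]; apply radius_sum; [exact Hx | lia].
      + assert (INR L <= INR m) by (apply le_INR; lia).
        replace (INR T * (80 / 2 ^ 13) / INR L) with (10 * INR T * (8 / 2 ^ 13 / INR L))
          by (field; lra).
        apply Rmult_le_compat_l; [lra|]; apply Rmult_le_compat_l; [lra|].
        apply Rinv_le_contravar; lra.
    - assert (H3 : INR (2 ^ m) <= INR D ^ 3).
      { unfold D; rewrite <- pow_INR, <- Nat.pow_mul_r; apply le_INR, Nat.pow_le_mono_r; lia. }
      apply Rmult_le_reg_r with (INR D); [lra|].
      replace (INR (2 ^ m) * (20 * INR (2 ^ m) / INR D) * INR D) with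
        (20 * (INR (2 ^ m) * INR (2 ^ m))) by (field; lra).
      replace (20 * INR D ^ 5 * INR D) with (20 * (INR D ^ 3 * INR D ^ 3)) by ring.
      apply Rmult_le_compat_l; [lra|]; apply Rmult_le_compat; lra. }
  rewrite mult_INR, Rmult_plus_distr_l; change (INR 2) with 2.
  replace (2 * INR L * (INR T * (80 / 2 ^ 13) / INR L)) with (INR T * (160 / 2 ^ 13))
    by (field; lra).
  (* With [L <= D] this reduces to [640 <= D^2], which holds because [L >= 5] gives [D >= 32]. *)
  assert (H40 : 2 * INR L * (20 * INR D ^ 5) <= INR T / 16).
  { rewrite ET.
    apply Rle_trans with (40 * INR D ^ 6).
    - replace (40 * INR D ^ 6) with (40 * INR D ^ 5 * INR D) by ring.
      replace (2 * INR L * (20 * INR D ^ 5)) with (40 * INR D ^ 5 * INR L) by ring.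
      apply Rmult_le_compat_l; [|exact PLD].
      assert (0 < INR D ^ 5) by (apply pow_lt; lra); lra.
    - replace (INR D ^ 8 / 16) with (INR D ^ 6 * (INR D * INR D / 16)) by field.
      rewrite (Rmult_comm 40); apply Rmult_le_compat_l; [apply pow_le; lra|nra]. }
  lra.
Qed.

Lemma Rpower_2pow_mono (s : R) (a n : nat) :
  s <= 1 -> (a <= n)%nat -> 12 * Rpower (2 ^ a) s <= 2 ^ a -> 12 * Rpower (2 ^ n) s <= 2 ^ n.
Proof.
  intros Hs Han H; replace n with (a + (n - a))%nat by lia; rewrite pow_add.
  assert (0 < 2 ^ a) by (apply pow_lt; lra).
  assert (1 <= 2 ^ (n - a)) by (apply pow_R1_Rle; lra).
  rewrite <- Rpower_mult_distr by lra.
  assert (Rpower (2 ^ (n - a)) s <= 2 ^ (n - a)).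
  { rewrite <- (Rpower_1 (2 ^ (n - a))) at 2 by lra; apply Rle_Rpower; lra. }
  pose proof (Rpower_pos (2 ^ a) s); pose proof (Rpower_pos (2 ^ (n - a)) s); nra.
Qed.

Lemma geometric_block (L m : nat) :
  (1 <= L <= m)%nat -> exists t, (3 ^ t * L <= m < 3 ^ S t * L)%nat.
Proof.
  intros [HL Hm].
  assert (H : forall n, (m < 3 ^ n * L)%nat -> exists t, (3 ^ t * L <= m < 3 ^ S t * L)%nat).
  { induction n as [|n IH]; intros Hn; [simpl in Hn; lia|].
    destruct (le_lt_dec (3 ^ n * L) m); [exists n; lia | apply IH; assumption]. }
  apply (H m); pose proof (Nat.pow_gt_lin_r 3 m); nia.
Qed.

(* A cell of level [S k] is kept when it misses the set excluded at level [k - 1] and at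
   most half of its children meet the set excluded at level [k]; the second condition
   makes the first one available at the next level. *)
Definition kept (x : R) (b L0 : nat) (k i : nat) : Prop :=
  (forall t, k = S t ->
     cnt (fun j => exists y, cell (2 ^ (3 ^ S k * L0)) (i * 2 ^ (2 * (3 ^ k * L0)) + j) y /\
            excluded x b (3 ^ t * L0) (3 ^ S t * L0) y) (2 ^ (2 * (3 ^ k * L0)))
       <= INR (2 ^ (2 * (3 ^ k * L0))) / 2) /\
  (forall t, k = S (S t) ->
     ~ exists y, cell (2 ^ (3 ^ k * L0)) i y /\ excluded x b (3 ^ t * L0) (3 ^ S t * L0) y).

(** At most a quarter of the children violate the half condition for the current block, and at most
    half meet the set of the preceding block, by the half condition on the parent; at [k = 0] there
    is no preceding block. A quarter remains. *)
Lemma kept_children (x : R) (b L0 k i : nat) :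
  (forall q, (1 <= q)%nat -> / 2 ^ b / INR q <= dist_int (INR q * x)) ->
  (5 <= L0)%nat -> (b + 1 <= L0)%nat -> kept x b L0 k i ->
  INR (2 ^ (2 * (3 ^ k * L0))) / 4 <=
    cnt (fun j => kept x b L0 (S k) (i * 2 ^ (2 * (3 ^ k * L0)) + j)) (2 ^ (2 * (3 ^ k * L0))).
Proof.
  intros Hx HL0 HbL0 [Hhalf _].
  set (L := (3 ^ k * L0)%nat) in *.
  assert (HL : (L0 <= L)%nat) by (unfold L; pose proof (Nat.pow_nonzero 3 k); nia).
  assert (E1 : (3 ^ S k * L0 = 3 * L)%nat) by (unfold L; rewrite Nat.pow_succ_r'; lia).
  assert (E2 : (3 ^ S (S k) * L0 = 9 * L)%nat) by (unfold L; rewrite !Nat.pow_succ_r'; lia).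
  pose proof (cells_meeting_excluded x b L i Hx ltac:(lia) ltac:(lia)) as Hcount.
  set (r := (2 ^ (2 * L))%nat) in *; set (r' := (2 ^ (6 * L))%nat).
  assert (ET : (2 ^ (8 * L) = r * r')%nat).
  { unfold r, r'; rewrite <- Nat.pow_add_r; f_equal; lia. }
  rewrite ET in Hcount.
  assert (ED : (2 ^ L * (r * r') = 2 ^ (9 * L))%nat).
  { unfold r, r'; rewrite <- !Nat.pow_add_r; f_equal; lia. }
  rewrite ED in Hcount.
  assert (Pr : 0 < INR r) by (apply lt_0_INR; unfold r; pose proof (Nat.pow_nonzero 2 (2 * L)); lia).
  assert (Pr' : 0 < INR r') by (apply lt_0_INR; unfold r'; pose proof (Nat.pow_nonzero 2 (6 * L)); lia).
  set (met := fun j => cnt (fun l => exists y, cell (2 ^ (9 * L)) ((i * r + j) * r' + l) y /\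
     excluded x b L (3 * L) y) r').
  assert (Hmet : rsum met r <= INR r * INR r' / 8).
  { rewrite <- mult_INR; apply Rle_trans with (2 := Hcount).
    unfold met, cnt; rewrite rsum_blocks; right.
    apply rsum_ext; intros j _; apply rsum_ext; intros l _.
    replace ((i * r + j) * r' + l)%nat with (i * (r * r') + (j * r' + l))%nat by ring.
    reflexivity. }
  set (heavy := fun j => INR r' / 2 < met j).
  (* Markov's inequality: a heavy child accounts for more than [r' / 2] of the at most [r r' / 8]
     grandchildren met. *)
  assert (Hheavy : cnt heavy r <= INR r / 4).
  { apply Rmult_le_reg_l with (INR r' / 2); [lra|].
    apply Rle_trans with (rsum met r); [|lra].
    unfold cnt; rewrite <- rsum_scal; apply rsum_le; intros j _.
    assert (0 <= met j) by (apply rsum_nonneg; intros; apply indicator_bounds).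
    destruct (classic (heavy j)) as [h|h].
    - rewrite (indicator_true _ h); unfold heavy in h; lra.
    - rewrite (indicator_false _ h); lra. }
  set (hits := fun j => exists t, k = S t /\ exists y, cell (2 ^ (3 * L)) (i * r + j) y /\
     excluded x b (3 ^ t * L0) (3 ^ S t * L0) y).
  assert (Hhits : cnt hits r <= INR r / 2).
  { destruct k as [|t].
    - replace (INR r / 2) with (INR r * (1 / 2)) by field.
      apply rsum_bound; intros j _; rewrite indicator_false; [lra|].
      intros [t [Ht _]]; discriminate.
    - specialize (Hhalf t eq_refl); rewrite E1 in Hhalf.
      apply Rle_trans with (2 := Hhalf); apply cnt_le; intros j _ [t' [Et' Hy]].
      injection Et' as <-; exact Hy. }
  assert (Hall : INR r <= cnt (fun j => kept x b L0 (S k) (i * r + j)) r +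
     cnt (fun j => heavy j \/ hits j) r).
  { apply cnt_compl; intros j Hj.
    destruct (classic (heavy j \/ hits j)) as [h|h]; [right; exact h|left].
    split.
    - intros t Et; injection Et as <-.
      rewrite E1, E2; fold L; replace (2 * (3 * L))%nat with (6 * L)%nat by lia; fold r'.
      apply Rnot_lt_le; intros Hlt; apply h; left; exact Hlt.
    - intros t Et Hy; injection Et as Et; apply h; right.
      exists t; rewrite E1 in Hy; auto. }
  pose proof (cnt_or heavy hits r); lra.
Qed.

(** The exponents of the scales triple at each level, starting from the cell [[0, 2^-L0]]. A block
    with [3^t L0 <= m < 3^(t+1) L0] is avoided from level [t + 2], where the scale is
    [2^-(9 * 3^t L0)]. *)
Lemma fibre_point (s e x : R) (a b L0 : nat) (w d : nat -> R) (V : nat -> R -> Prop) :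
  0 <= s <= 1 -> 12 * Rpower (2 ^ a) s <= 2 ^ a ->
  (forall q, (1 <= q)%nat -> / 2 ^ b / INR q <= dist_int (INR q * x)) ->
  (5 <= L0)%nat -> (b + 1 <= L0)%nat -> (a <= L0)%nat ->
  (forall n, 0 <= w n) -> (forall n, 0 < d n) ->
  (forall n x y, V n x -> V n y -> Rabs (x - y) <= d n) ->
  (forall N, rsum (fun n => w n * Rpower (d n) s) N <= e) ->
  exists y, (forall m r, (L0 <= m)%nat -> (r < 2 ^ m)%nat ->
      radius x b m r <= dist_int (INR (2 ^ m + r) * y)) /\
    forall N, rsum (fun n => w n * indicator (V n y)) N <= 12 * Rpower (2 ^ L0) s * e.
Proof.
  intros Hs Ha Hx HL0 HbL0 HaL0 Hw Hd HV He.
  assert (HLk : forall k, (L0 <= 3 ^ k * L0)%nat).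
  { intros k; pose proof (Nat.pow_nonzero 3 k); nia. }
  destruct (tree_point s e (fun k => 2 ^ (3 ^ k * L0))%nat (fun k => 2 ^ (2 * (3 ^ k * L0)))%nat
    (kept x b L0) w d V) as [y [Hy Hsum]]; auto.
  - pose proof (Nat.pow_nonzero 2 (3 ^ 0 * L0)); lia.
  - intros k; rewrite <- Nat.pow_add_r; f_equal; rewrite Nat.pow_succ_r'; lia.
  - intros k; apply (Nat.pow_le_mono_r 2 1); specialize (HLk k); lia.
  - intros k; rewrite pow_INR; change (INR 2) with 2.
    apply Rpower_2pow_mono with a; auto; [lra | specialize (HLk k); lia].
  - split; intros; discriminate.
  - intros k i Hk; apply kept_children; auto.
  - exists y; split.
    + intros m r Hm Hr.
      destruct (geometric_block L0 m ltac:(lia)) as [t Ht].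
      destruct (Hy (S (S t))) as [i [[_ Hmiss] Hi]].
      apply Rnot_lt_le; intros Hlt; apply (Hmiss t eq_refl).
      exists y; split; [exact Hi|]; exists m, r; auto.
    + intros N; specialize (Hsum N); rewrite pow_INR in Hsum.
      replace (3 ^ 0 * L0)%nat with L0 in Hsum by (simpl; lia).
      exact Hsum.
Qed.

(** * Lower bound *)

(** The inequality says [12 <= 2^(a (1 - s))], which holds for large [a] because [s < 1]. *)
Lemma exists_large_base (s : R) :
  s < 1 -> exists a, (4 <= a)%nat /\ 12 * Rpower (2 ^ a) s <= 2 ^ a.
Proof.
  intros Hs.
  assert (Hln2 : 0 < ln 2) by (rewrite <- ln_1; apply ln_increasing; lra).
  destruct (INR_unbounded (ln 12 / ((1 - s) * ln 2))) as [a0 Ha0].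
  exists (4 + a0)%nat; split; [lia|].
  set (a := (4 + a0)%nat).
  assert (Ha : ln 12 <= INR a * ((1 - s) * ln 2)).
  { apply Rle_trans with (ln 12 / ((1 - s) * ln 2) * ((1 - s) * ln 2)); [right; field; lra|].
    apply Rmult_le_compat_r; [nra|].
    apply Rle_trans with (INR a0); [lra | apply le_INR; unfold a; lia]. }
  assert (P : 0 < 2 ^ a) by (apply pow_lt; lra).
  unfold Rpower; rewrite <- (exp_ln (2 ^ a)) at 2 by exact P.
  rewrite <- (exp_ln 12) by lra; rewrite <- exp_plus, ln_pow by lra.
  destruct (Rle_lt_or_eq_dec (ln 12 + s * (INR a * ln 2)) (INR a * ln 2)) as [H|H]; [nra| |].
  - left; apply exp_increasing, H.
  - rewrite H; lra.
Qed.

Lemma in_bad_set (x y : R) (b L0 : nat) :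
  (forall q, (1 <= q)%nat -> / 2 ^ b / INR q <= dist_int (INR q * x)) ->
  (1 <= L0)%nat ->
  (forall m r, (L0 <= m)%nat -> (r < 2 ^ m)%nat ->
     radius x b m r <= dist_int (INR (2 ^ m + r) * y)) ->
  bad_set (x, y).
Proof.
  intros Hx HL0 Hy.
  assert (Hln2 : 0 < ln 2) by (rewrite <- ln_1; apply ln_increasing; lra).
  exists (/ 2 ^ (b + 13) * (ln 2) ^ 2); split.
  { apply Rmult_lt_0_compat; [apply Rinv_0_lt_compat|]; apply pow_lt; lra. }
  exists (2 ^ L0)%nat; intros n Hn; cbv zeta; simpl fst; simpl snd.
  set (q := S n); set (m := Nat.log2 q).
  destruct (Nat.log2_spec q ltac:(unfold q; lia)) as [Hm1 Hm2]; fold m in Hm1, Hm2.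
  assert (Hm : (L0 <= m)%nat) by (apply Nat.log2_le_pow2; unfold q; lia).
  rewrite Nat.pow_succ_r' in Hm2.
  specialize (Hy m (q - 2 ^ m)%nat Hm ltac:(lia)).
  unfold radius in Hy; replace (2 ^ m + (q - 2 ^ m))%nat with q in Hy by lia.
  pose proof (dist_int_bad_pos x b Hx q ltac:(unfold q; lia)) as Hdx.
  assert (P2m : 0 < 2 ^ m) by (apply pow_lt; lra).
  assert (Pm : 1 <= INR m) by (replace 1 with (INR 1) by reflexivity; apply le_INR; lia).
  assert (Hq : 2 ^ m <= INR q).
  { replace (2 ^ m) with (INR (2 ^ m)) by (rewrite pow_INR; reflexivity); apply le_INR, Hm1. }
  assert (Hlq : INR m * ln 2 <= ln (INR q)).
  { rewrite <- ln_pow by lra.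
    destruct Hq as [Hq|Hq]; [left; apply ln_increasing; assumption | rewrite Hq; lra]. }
  set (dx := dist_int (INR q * x)) in *; set (dy := dist_int (INR q * y)) in *.
  (* Replacing [q] by [2^m], [ln q] by [m ln 2] and [dy] by the radius makes everything cancel
     except the chosen constant. *)
  apply Rle_trans with (2 ^ m * (INR m * ln 2) ^ 2 * dx *
    (/ 2 ^ (b + 13) / (2 ^ m * INR m ^ 2 * dx))).
  - right; field; repeat split; try lra; apply pow_nonzero; lra.
  - assert (P2b : 0 < / 2 ^ (b + 13)) by (apply Rinv_0_lt_compat, pow_lt; lra).
    assert (0 <= INR m * ln 2) by nra.
    apply Rmult_le_compat; [| |apply Rmult_le_compat_r; [lra|]; apply Rmult_le_compat| exact Hy].
    + apply Rmult_le_pos; [apply Rmult_le_pos; [lra | apply pow_le; lra] | lra].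
    + left; apply Rdiv_lt_0_compat; [exact P2b|].
      apply Rmult_lt_0_compat; [apply Rmult_lt_0_compat; [lra | apply pow_lt; lra] | lra].
    + lra.
    + apply pow_le; lra.
    + exact Hq.
    + apply pow_incr; lra.
Qed.

Lemma dist2_fst (x y : R * R) : Rabs (fst x - fst y) <= dist2 x y.
Proof.
  unfold dist2; rewrite <- sqrt_Rsqr_abs; apply sqrt_le_1_alt; unfold Rsqr.
  pose proof (pow2_ge_0 (snd x - snd y)); simpl in *; lra.
Qed.

Lemma dist2_snd (x y : R * R) : Rabs (snd x - snd y) <= dist2 x y.
Proof.
  unfold dist2; rewrite <- sqrt_Rsqr_abs; apply sqrt_le_1_alt; unfold Rsqr.
  pose proof (pow2_ge_0 (fst x - fst y)); simpl in *; lra.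
Qed.

(* Slicing: the weights [d n ^ (s/2)] on the projections yield an abscissa [x] over which
   the slices of the cover still have small [s/2]-dimensional sum. *)
Lemma bad_set_not_null (s : R) : 0 <= s < 2 -> ~ hausdorff_null s bad_set.
Proof.
  intros Hs Hnull.
  set (t := s / 2); assert (Ht : 0 <= t <= 1) by (unfold t; lra).
  destruct (exists_large_base t) as [a [Ha Hbase]]; [unfold t; lra|].
  set (b := (2 * a + 2)%nat); set (L0 := (b + 1)%nat).
  pose proof (Rpower_pos (2 ^ L0) t) as PL.
  (* The two descents cost the factors 12 and [12 * 2^(L0 t)]; 288 is twice 144, so the final sum is
     at most one half, while a point in some [U n] forces it to be at least 1. *)
  set (eps := / (288 * Rpower (2 ^ L0) t)).
  assert (Peps : 0 < eps) by (apply Rinv_0_lt_compat; lra).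
  destruct (Hnull eps Peps) as [U [d [Hd [HU [Hcov Hsum]]]]].
  destruct (badly_approximable_point t eps a (fun n => Rpower (d n) t) d
    (fun n x => exists y, U n (x, y))) as [x [Hx Hxsum]]; auto.
  { intros n; left; apply Rpower_pos. }
  { intros n x x' [y Hy] [y' Hy'].
    apply Rle_trans with (2 := HU n _ _ Hy Hy'); apply (dist2_fst (x, y) (x', y')). }
  { intros [|N]; [simpl; lra|].
    apply Rle_trans with (2 := Hsum N); rewrite sum_f_R0_rsum; right.
    apply rsum_ext; intros n _; rewrite <- Rpower_plus; f_equal; unfold t; lra. }
  (* The weight now records whether the slice of [U n] over [x] is nonempty, so its hypothesis is
     exactly the sum bounded by the first descent. *)
  destruct (fibre_point t (12 * eps) x a b L0 (fun n => indicator (exists y, U n (x, y))) d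
    (fun n y => U n (x, y))) as [y [Hy Hysum]]; auto; try (unfold L0, b; lia).
  { intros n; apply indicator_bounds. }
  { intros n y y' Hy Hy'.
    apply Rle_trans with (2 := HU n _ _ Hy Hy'); apply (dist2_snd (x, y) (x, y')). }
  { intros N; apply Rle_trans with (2 := Hxsum N); right.
    apply rsum_ext; intros n _; ring. }
  destruct (Hcov (x, y)) as [n Hn].
  { apply (in_bad_set x y b L0); auto; unfold L0; lia. }
  specialize (Hysum (S n)).
  assert (H1 : 1 <= rsum (fun n => indicator (exists y, U n (x, y)) * indicator (U n (x, y))) (S n)).
  { apply Rle_trans with (indicator (exists y, U n (x, y)) * indicator (U n (x, y))).
    - rewrite (indicator_true _ Hn), indicator_true by (exists y; exact Hn); lra.
    - apply (rsum_term_le (fun n => indicator (exists y, U n (x, y)) * indicator (U n (x, y))));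
        [|lia].
      intros j; apply Rmult_le_pos; apply indicator_bounds. }
  assert (E : 12 * Rpower (2 ^ L0) t * (12 * eps) = / 2) by (unfold eps; field; lra).
  rewrite E in Hysum; lra.
Qed.

(** * Upper bound *)

Lemma ln_succ_sub_ge (x : R) : 0 < x -> / (x + 1) <= ln (x + 1) - ln x.
Proof.
  intros Hx; pose proof (exp_ineq1_le (- / (x + 1))) as H.
  assert (E : 1 + - / (x + 1) = x / (x + 1)) by (field; lra).
  rewrite E in H.
  assert (Hl : ln (x / (x + 1)) <= - / (x + 1)).
  { rewrite <- (ln_exp (- / (x + 1))).
    assert (0 < x / (x + 1)) by (apply Rdiv_lt_0_compat; lra).
    destruct H as [H|H]; [left; apply ln_increasing; assumption | rewrite H; lra]. }
  unfold Rdiv in Hl; rewrite ln_mult, ln_Rinv in Hl; try apply Rinv_0_lt_compat; lra.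
Qed.

Lemma p_series_bound (eta : R) (N : nat) :
  0 < eta -> rsum (fun n => Rpower (INR (S n)) (- (1 + eta))) N <= 1 + / eta.
Proof.
  intros He; assert (Pie : 0 < / eta) by (apply Rinv_0_lt_compat, He).
  destruct N as [|N]; [simpl; lra|].
  (* Strengthened induction hypothesis, from comparison with the integral of [x^-(1+eta)]; the steps
     telescope. *)
  apply Rle_trans with (1 + / eta * (1 - Rpower (INR (S N)) (- eta))).
  2:{ pose proof (Rpower_pos (INR (S N)) (- eta)); nra. }
  induction N as [|N IH].
  - simpl; unfold Rpower; rewrite ln_1, !Rmult_0_r, exp_0; lra.
  - change (rsum (fun n => Rpower (INR (S n)) (- (1 + eta))) (S (S N))) with
      (rsum (fun n => Rpower (INR (S n)) (- (1 + eta))) (S N) +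
       Rpower (INR (S (S N))) (- (1 + eta))).
    rewrite (S_INR (S N)); set (x := INR (S N)) in *.
    assert (Px : 0 < x) by (apply lt_0_INR; lia).
    assert (Hstep : Rpower (x + 1) (- (1 + eta)) <=
      / eta * (Rpower x (- eta) - Rpower (x + 1) (- eta))).
    { pose proof (ln_succ_sub_ge x Px) as Hl.
      set (P := Rpower (x + 1) (- eta)).
      assert (PP : 0 < P) by apply Rpower_pos.
      assert (E1 : Rpower (x + 1) (- (1 + eta)) = P * / (x + 1)).
      { replace (- (1 + eta)) with (- eta + Ropp 1) by ring.
        rewrite Rpower_plus; fold P; rewrite Rpower_Ropp, Rpower_1 by lra; reflexivity. }
      assert (E2 : Rpower x (- eta) = P * exp (eta * (ln (x + 1) - ln x))).
      { unfold P, Rpower; rewrite <- exp_plus; f_equal; ring. }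
      rewrite E1, E2.
      pose proof (exp_ineq1_le (eta * (ln (x + 1) - ln x))) as Hexp.
      apply Rmult_le_reg_l with eta; [exact He|].
      replace (eta * (/ eta * (P * exp (eta * (ln (x + 1) - ln x)) - P))) with
        (P * (exp (eta * (ln (x + 1) - ln x)) - 1)) by (field; lra).
      replace (eta * (P * / (x + 1))) with (P * (eta * / (x + 1))) by ring.
      apply Rmult_le_compat_l; [lra|].
      apply Rmult_le_compat_l with (r := eta) in Hl; lra. }
    lra.
Qed.

(* Index [4^k + i 2^k + j] with [i, j < 2^k] stands for the point [(i, j)] of the [k]-th grid. *)
Definition grid_level (n : nat) : nat := (Nat.log2 n / 2)%nat.
Definition grid_row (n : nat) : nat := ((n - 4 ^ grid_level n) / 2 ^ grid_level n)%nat.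
Definition grid_col (n : nat) : nat := ((n - 4 ^ grid_level n) mod 2 ^ grid_level n)%nat.

(** The [k]-th grid occupies the indices from [4^k] to [2 * 4^k - 1], on which [Nat.log2] equals
    [2 k]. *)
Lemma grid_index (k i j : nat) :
  (i < 2 ^ k)%nat -> (j < 2 ^ k)%nat ->
  exists n, grid_level n = k /\ grid_row n = i /\ grid_col n = j /\ (S n <= 4 ^ S k)%nat.
Proof.
  intros Hi Hj; exists (4 ^ k + (i * 2 ^ k + j))%nat.
  assert (E4 : (4 ^ k = 2 ^ (2 * k))%nat) by (rewrite Nat.pow_mul_r; reflexivity).
  assert (E4' : (4 ^ k = 2 ^ k * 2 ^ k)%nat) by (rewrite <- Nat.pow_mul_l; reflexivity).
  assert (Hr : (i * 2 ^ k + j < 4 ^ k)%nat) by nia.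
  assert (Hlev : grid_level (4 ^ k + (i * 2 ^ k + j)) = k).
  { unfold grid_level; rewrite (Nat.log2_unique _ (2 * k)); [|lia|].
    - rewrite Nat.mul_comm; apply Nat.div_mul; lia.
    - rewrite Nat.pow_succ_r', <- E4; lia. }
  unfold grid_row, grid_col; rewrite Hlev.
  replace (4 ^ k + (i * 2 ^ k + j) - 4 ^ k)%nat with (i * 2 ^ k + j)%nat by lia.
  repeat split.
  - rewrite Nat.div_add_l, Nat.div_small by lia; lia.
  - rewrite Nat.add_comm, Nat.Div0.mod_add, Nat.mod_small; auto.
  - rewrite Nat.pow_succ_r'; lia.
Qed.

Lemma grid_coordinate (g x : R) (k : nat) :
  0 < g -> Rabs x < 2 ^ k / 2 * g ->
  exists i, (i < 2 ^ k)%nat /\ Rabs (x - (INR i - 2 ^ k / 2) * g) <= g.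
Proof.
  intros Hg Hx; set (z := x / g + 2 ^ k / 2).
  destruct (base_Int_part z) as [H1 H2].
  assert (Ex : x / g * g = x) by (field; lra).
  apply Rabs_def2 in Hx.
  assert (Hz : 0 < z < 2 ^ k).
  { unfold z; split; apply Rmult_lt_reg_r with g; try exact Hg; nra. }
  assert (HZ : (0 <= Int_part z)%Z).
  { assert (-1 < Int_part z)%Z by (apply lt_IZR; lra); lia. }
  assert (E : INR (Z.to_nat (Int_part z)) = IZR (Int_part z)).
  { rewrite INR_IZR_INZ, Z2Nat.id by exact HZ; reflexivity. }
  exists (Z.to_nat (Int_part z)); split.
  - apply INR_lt; rewrite E, pow_INR; change (INR 2) with 2; lra.
  - rewrite E; replace (x - (IZR (Int_part z) - 2 ^ k / 2) * g) with
      ((z - IZR (Int_part z)) * g) by (unfold z; field; lra).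
    rewrite Rabs_right; [nra|]; apply Rle_ge, Rmult_le_pos; lra.
Qed.

(** Each coordinate differs by at most [2 h], so the distance is at most [2 sqrt 2 h <= 3 h]. *)
Lemma dist2_square (c1 c2 h d : R) (p p' : R * R) :
  3 * h = d ->
  Rabs (fst p - c1) <= h /\ Rabs (snd p - c2) <= h ->
  Rabs (fst p' - c1) <= h /\ Rabs (snd p' - c2) <= h -> dist2 p p' <= d.
Proof.
  intros Hd [H1 H2] [H3 H4].
  assert (Hh : 0 <= h) by (apply Rle_trans with (2 := H1), Rabs_pos).
  assert (A : forall u v c, Rabs (u - c) <= h -> Rabs (v - c) <= h -> (u - v) ^ 2 <= 4 * h ^ 2).
  { intros u v c Hu Hv.
    assert (Huv : Rabs (u - v) <= 2 * h).
    { replace (u - v) with ((u - c) - (v - c)) by ring.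
      apply Rle_trans with (1 := Rabs_triang (u - c) (- (v - c))); rewrite Rabs_Ropp; lra. }
    rewrite <- pow2_abs; pose proof (Rabs_pos (u - v)); nra. }
  pose proof (A _ _ _ H1 H3); pose proof (A _ _ _ H2 H4).
  unfold dist2; rewrite <- (sqrt_pow2 d) by lra; apply sqrt_le_1_alt; subst d; nra.
Qed.

(* The [n]-th square has side of order [n^(-tau/2)] with [2/s < tau < 1]: the [4^k] squares
   of the [k]-th grid then cover a box of side [2^(k (1 - tau))], unbounded in [k]. *)
Lemma null_above_two (s : R) (E : R * R -> Prop) : 2 < s -> hausdorff_null s E.
Proof.
  intros Hs eps Heps.
  (* [tau] is the midpoint of [2 / s] and 1, and [s tau / 2 = 1 + eta], so the diameters raised to
     [s] form a convergent [p]-series. *)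
  set (tau := / s + / 2); set (eta := (s - 2) / 4).
  assert (Pis : 0 < / s < / 2) by (split; [apply Rinv_0_lt_compat | apply Rinv_lt_contravar]; lra).
  assert (Htau : 0 < tau < 1) by (unfold tau; lra).
  assert (Heta : 0 < eta) by (unfold eta; lra).
  assert (Pie : 0 < / eta) by (apply Rinv_0_lt_compat, Heta).
  assert (Hln2 : 0 < ln 2) by (rewrite <- ln_1; apply ln_increasing; lra).
  (* Chosen so that [K^s] times the bound [1 + / eta] of the series is [eps]. *)
  set (K := Rpower (eps / (1 + / eta)) (/ s)).
  assert (PK : 0 < K) by apply Rpower_pos.
  assert (EK : Rpower K s = eps / (1 + / eta)).
  { unfold K; rewrite Rpower_mult, Rinv_l, Rpower_1; [reflexivity | | lra].
    apply Rdiv_lt_0_compat; lra. }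
  set (d n := K * Rpower (INR (S n)) (- (tau / 2))).
  (* The mesh of the [k]-th grid: indices in that grid satisfy [n + 1 <= 4^(k+1)], hence
     [g k <= d n / 3], the half-side of the square. *)
  set (g k := K / 3 * Rpower 2 (- (INR (S k) * tau))).
  assert (Pd : forall n, 0 < d n) by (intros; apply Rmult_lt_0_compat; [exact PK | apply Rpower_pos]).
  assert (Pg : forall k, 0 < g k) by (intros; apply Rmult_lt_0_compat; [lra | apply Rpower_pos]).
  set (ctr k i := (INR i - 2 ^ k / 2) * g k).
  exists (fun n p => Rabs (fst p - ctr (grid_level n) (grid_row n)) <= d n / 3 /\
                     Rabs (snd p - ctr (grid_level n) (grid_col n)) <= d n / 3), d.
  repeat split.
  - exact Pd.
  - intros n p p' Hp Hp'; refine (dist2_square _ _ (d n / 3) (d n) p p' _ Hp Hp'); field.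
  - intros [x y] _; cbv beta; simpl fst; simpl snd.
    set (X := Rabs x + Rabs y).
    assert (HX : exists k, X < 2 ^ k / 2 * g k).
    { destruct (INR_unbounded (12 * X / K / ((1 - tau) * ln 2))) as [k Hk]; exists k.
      assert (E1 : 2 ^ k / 2 * g k = K / 12 * Rpower 2 (INR (S k) * (1 - tau))).
      { unfold g; replace (INR (S k) * (1 - tau)) with (INR (S k) + - (INR (S k) * tau)) by ring.
        rewrite (Rpower_plus (INR (S k))), Rpower_pow by lra.
        simpl; field. }
      rewrite E1; unfold Rpower.
      pose proof (exp_ineq1_le (INR (S k) * (1 - tau) * ln 2)) as Hexp.
      assert (Pt : 0 < (1 - tau) * ln 2) by nra.
      apply (Rmult_lt_compat_r ((1 - tau) * ln 2)) in Hk; [|exact Pt].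
      replace (12 * X / K / ((1 - tau) * ln 2) * ((1 - tau) * ln 2)) with (12 * X / K) in Hk
        by (field; lra).
      rewrite S_INR in *.
      apply Rlt_le_trans with (K / 12 * (INR k * ((1 - tau) * ln 2))).
      - apply (Rmult_lt_compat_l (K / 12)) in Hk; [|lra].
        replace (K / 12 * (12 * X / K)) with X in Hk by (field; lra); exact Hk.
      - apply Rmult_le_compat_l; [lra|]; nra. }
    destruct HX as [k Hk].
    pose proof (Rabs_pos x); pose proof (Rabs_pos y).
    destruct (grid_coordinate (g k) x k (Pg k)) as [i [Hi Hxi]]; [unfold X in Hk; lra|].
    destruct (grid_coordinate (g k) y k (Pg k)) as [j [Hj Hyj]]; [unfold X in Hk; lra|].
    destruct (grid_index k i j Hi Hj) as [n [E1 [E2 [E3 Hn]]]].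
    assert (Hgd : g k <= d n / 3).
    { unfold g, d.
      replace (K * Rpower (INR (S n)) (- (tau / 2)) / 3) with
        (K / 3 * Rpower (INR (S n)) (- (tau / 2))) by field.
      apply Rmult_le_compat_l; [lra|]; unfold Rpower.
      assert (Hln : ln (INR (S n)) <= INR (S k) * (2 * ln 2)).
      { replace (INR (S k) * (2 * ln 2)) with (ln (INR (4 ^ S k))).
        - apply le_INR in Hn; assert (0 < INR (S n)) by (apply lt_0_INR; lia).
          destruct Hn as [Hn|Hn]; [left; apply ln_increasing; assumption | rewrite Hn; lra].
        - rewrite pow_INR, ln_pow by (simpl; lra); f_equal.
          replace (INR 4) with (2 ^ 2) by (simpl; lra).
          rewrite ln_pow by lra; simpl; ring. }
      assert (Hle : - (INR (S k) * tau) * ln 2 <= - (tau / 2) * ln (INR (S n))) by nra.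
      destruct Hle as [Hle|Hle]; [left; apply exp_increasing, Hle | rewrite Hle; lra]. }
    exists n; rewrite E1, E2, E3; unfold ctr; lra.
  - intros N; rewrite sum_f_R0_rsum.
    rewrite (rsum_ext _ (fun n => eps / (1 + / eta) * Rpower (INR (S n)) (- (1 + eta)))).
    2:{ intros n _; unfold d.
        rewrite <- Rpower_mult_distr, EK, Rpower_mult; [|exact PK|apply Rpower_pos].
        f_equal; f_equal; unfold tau, eta; field; lra. }
    rewrite rsum_scal; pose proof (p_series_bound eta (S N) Heta) as HP.
    apply Rle_trans with (eps / (1 + / eta) * (1 + / eta)); [|right; field; split; lra].
    apply Rmult_le_compat_l; [left; apply Rdiv_lt_0_compat; lra | exact HP].
Qed.

Theorem theorem2 : hausdorff_dim bad_set 2.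
Proof.
  split.
  - intros s [Hs Hnull]; apply Rnot_lt_le; intros Hlt.
    apply (bad_set_not_null s); [lra | exact Hnull].
  - intros m Hm; apply Rnot_lt_le; intros Hlt.
    (* If [m > 2], the midpoint of 2 and [m] is an admissible exponent below the supposed lower
       bound. *)
    assert (m <= (m + 2) / 2); [|lra].
    apply Hm; split; [lra|]; apply null_above_two; lra.
Qed.
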